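(* Fix $\tau\in\mathbb{Z}$. For every integer $m\geq 1$, the function $$g_m(q,a)=\sum_{d\mid m}\mu(d)\,\mathcal{Z}_{m/d}(q^d,a^d)$$ (with $\mu$ the Möbius function) lies in $z^{-2}\mathbb{Z}[z^2,a^{\pm\frac12}]$, where $z=q^{\frac12}-q^{-\frac12}$. Consequently, writing $g_m(q,a)=\sum_{g\ge0}\sum_{Q\in\frac12\mathbb{Z}} n_{m,g,Q}(\tau)z^{2g-2}a^Q$, all $n_{m,g,Q}(\tau)$ are integers and only finitely many are nonzero.
   Context: For an integer $n$ and a variable $x$, set $\{n\}_x=x^{n/2}-x^{-n/2}$, and $\{n\}=\{n\}_q$. For a partition $\nu=(\nu_1\ge\nu_2\ge\dots\ge\nu_{l(\nu)})$ set $\{\nu\}_x=\prod_{i=1}^{l(\nu)}\{\nu_i\}_x$, $\{\nu\}=\{\nu\}_q$, and for an integer $c$, $\{c\nu\}=\prod_i\{c\nu_i\}$. Let $|\nu|=\sum_i\nu_i$ and $\mathfrak{z}_\nu=|\mathrm{Aut}(\nu)|\prod_i\nu_i=\prod_{j\ge1} j^{m_j}m_j!$, where $m_j$ is the number of parts of $\nu$ equal to $j$. For $n\ge1$ define the rational function $$\mathcal{Z}_n(q,a)=(-1)^{n\tau}\sum_{|\nu|=n}\frac{1}{\mathfrak{z}_\nu}\,\frac{\{n\nu\tau\}}{\{n\}\{n\tau\}}\,\frac{\{\nu\}_a}{\{\nu\}},$$ where the quotient $\{n\nu\tau\}/\{n\tau\}$ means the Laurent polynomial $\Big(\sum_{k=0}^{\nu_1-1}q^{n\tau(\nu_1-1-2k)/2}\Big)\prod_{i\ge2}\{n\nu_i\tau\}$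 (which equals the literal quotient when $\tau\neq0$). The statement ''$g_m\in z^{-2}\mathbb{Z}[z^2,a^{\pm1/2}]$'' means that $g_m$, as a rational function of $q^{1/2},a^{1/2}$, equals $z^{-2}$ times a polynomial in $z^2$ with integer coefficients in $a^{\pm1/2}$. *)

(* Defs.v *)
From HB Require Import structures.
From mathcomp Require Import all_boot all_order all_algebra fraction.
Set Implicit Arguments. Unset Strict Implicit. Unset Printing Implicit Defensive.
Import Order.TTheory GRing.Theory Num.Theory.
Local Open Scope ring_scope.

Fixpoint words (k n : nat) : seq (seq nat) :=
  if k is k'.+1 then [seq x :: w | x <- iota 1 n, w <- words k' n] else [:: [::]].

Definition is_partition (n : nat) (nu : seq nat) : bool :=
  [&& all (fun x => 0 < x)%N nu, sorted geq nu & sumn nu == n].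

(* the (duplicate-free) list of all partitions of n; every partition of n has
   length <= n and parts in 1..n, so it occurs among the candidates *)
Definition partitions (n : nat) : seq (seq nat) :=
  undup [seq nu <- flatten [seq words k n | k <- iota 0 n.+1] | is_partition n nu].

Definition zfrak (nu : seq nat) : nat :=
  \prod_(1 <= j < (sumn nu).+1) (j ^ count_mem j nu * (count_mem j nu)`!)%N.

Definition mobius (n : nat) : int :=
  if n == 0%N then 0
  else if all (fun p => logn p n == 1%N) (primes n) then (-1) ^+ size (primes n)
  else 0.

Section Q.
Variable F : fieldType.

(* {k}_x with x = s^2, i.e. s = x^{1/2}: s^k - s^{-k} *)
Definition qbr (s : F) (k : int) : F := s ^ k - s ^ (- k).

(* the Laurent polynomial {n nu tau}/{n tau} (in q = s^2) *)
Definition qquot (tau : int) (n : nat) (nu : seq nat) (s : F) : F :=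
  match nu with
  | nu1 :: rest =>
      (\sum_(k < nu1) s ^ (n%:Z * tau * (nu1%:Z - 1 - 2 * k%:Z)))
      * \prod_(x <- rest) qbr s (n%:Z * x%:Z * tau)
  | [::] => 1
  end.

(* Z_n(q,a) with q = s^2, a = t^2 *)
Definition Zn (tau : int) (n : nat) (s t : F) : F :=
  (-1) ^ (n%:Z * tau) *
  \sum_(nu <- partitions n)
     ((zfrak nu)%:R)^-1 * (qquot tau n nu s / (qbr s n%:Z))
       * ((\prod_(x <- nu) qbr t x%:Z) / (\prod_(x <- nu) qbr s x%:Z)).

Definition gm (tau : int) (m : nat) (s t : F) : F :=
  \sum_(d <- divisors m) (mobius d)%:~R * Zn tau (m %/ d) (s ^+ d) (t ^+ d).
End Q.

Definition Kfield := {fraction {poly {poly int}}}.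
(* qh = q^{1/2}, ah = a^{1/2} *)
Definition qh : Kfield := FracField.tofrac ('X : {poly {poly int}}).
Definition ah : Kfield := FracField.tofrac ((('X : {poly int})%:P) : {poly {poly int}}).
Definition zvar : Kfield := qh - qh^-1.

(* Main.v *)
(** The power sums [{N k} {k}_a / {k}] with [N = n tau] turn the sum over
    partitions in [Z_n] into a complete symmetric function, which Newton's
    identities and the q-binomial theorem evaluate.  For [tau > 0] this gives
    [{n}^2 Z_n = sum_j (-1)^(n tau + j) a^(n/2 - j) [n, j] [n tau + n - j - 1, n - 1]]
    with symmetric Gaussian binomials, polynomials over Z in [w = q^(1/2) + q^(-1/2)].
    Hence the coefficients of [{m}^2 g_m] are Moebius sums of such polynomials, and
    what has to be shown is that [({m}/{1})^2] divides them, i.e. that they vanish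
    to order two at each [q] of order [k > 1] dividing [m].  There a q-Lucas
    congruence to second order says that, for a prime [p] dividing [k], the summands
    attached to [d] and [p d] cancel up to order two.  Invariance under
    [q^(1/2) -> - q^(1/2)] makes the quotient a polynomial in [w^2 = z^2 + 4].
    Negative [tau] reduces to positive [tau] by [a -> a^(-1)]. *)

Require Import Defs.
From HB Require Import structures.
From mathcomp Require Import all_boot all_order all_algebra all_field fraction.
From mathcomp Require Import zify ring.
Import Order.TTheory GRing.Theory Num.Theory.
Local Open Scope ring_scope.
Set Implicit Arguments. Unset Strict Implicit. Unset Printing Implicit Defensive.

(** * Symmetric Gaussian binomials as polynomials in [s + s^-1] *)

(** Identities are proved once for integral polynomials in w and then evaluated in several rings:
    the field of rational functions, the algebraic numbers and the dual numbers. *)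
Definition ev (R : comNzRingType) (w : R) (P : {poly int}) : R :=
  (map_poly intr P).[w].

Section Ev.
Variables (R : comNzRingType) (w : R).

Lemma ev_is_zmod : zmod_morphism (ev w).
Proof. by move=> P Q; rewrite /ev rmorphB hornerD hornerN. Qed.

Lemma ev_is_monoid : monoid_morphism (ev w).
Proof.
by split=> [|P Q]; rewrite /ev ?rmorph1 ?hornerC // rmorphM hornerM.
Qed.

HB.instance Definition _ := GRing.isZmodMorphism.Build {poly int} R (ev w) ev_is_zmod.
HB.instance Definition _ := GRing.isMonoidMorphism.Build {poly int} R (ev w) ev_is_monoid.

Lemma evX : ev w 'X = w.
Proof. by rewrite /ev map_polyX hornerX. Qed.

Lemma evD P Q : ev w (P + Q) = ev w P + ev w Q. Proof. exact: rmorphD. Qed.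
Lemma evN P : ev w (- P) = - ev w P. Proof. exact: rmorphN. Qed.
Lemma evM P Q : ev w (P * Q) = ev w P * ev w Q. Proof. exact: rmorphM. Qed.
Lemma ev0 : ev w 0 = 0. Proof. exact: rmorph0. Qed.
Lemma ev1 : ev w 1 = 1. Proof. exact: rmorph1. Qed.
Lemma ev_nat n : ev w n%:R = n%:R. Proof. exact: rmorph_nat. Qed.
Definition evE := (ev0, ev1, ev_nat, evD, evN, evM, evX).

Lemma ev_comp P Q : ev w (P \Po Q) = ev (ev w Q) P.
Proof. by rewrite /ev map_comp_poly horner_comp. Qed.
End Ev.

(* [{n}/{1}] as a polynomial in [w = s + s^-1]: Chebyshev polynomials of the second
   kind, shifted so that [chebU n] has degree [n - 1]. *)
Fixpoint chebU (n : nat) : {poly int} :=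
  match n with
  | 0 => 0
  | 1 => 1
  | (n'.+1 as m).+1 => 'X * chebU m - chebU n'
  end.

Lemma chebUSS n : chebU n.+2 = 'X * chebU n.+1 - chebU n.
Proof. by []. Qed.

Lemma chebU1 : chebU 1 = 1. Proof. by []. Qed.
Lemma chebU0 : chebU 0 = 0. Proof. by []. Qed.

Lemma chebU_add a b :
  chebU (a + b).+1 = chebU a.+1 * chebU b.+1 - chebU a * chebU b.
Proof.
elim: a b => [|a IH] b; first by rewrite add0n chebU1 chebU0 mul1r mul0r subr0.
by rewrite addSnnS IH chebUSS chebUSS; ring.
Qed.

Lemma size_chebU n : size (chebU n) = n /\ (n != 0 -> chebU n \is monic)%N.
Proof.
elim/ltn_ind: n => -[|[|n]] IH.
- by rewrite chebU0 size_poly0.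
- by rewrite chebU1 size_poly1 monic1.
have [s1 m1] := IH n.+1 (ltnSn _); have [s0 _] := IH n (leqnSn _).
have sX : size ('X * chebU n.+1) = n.+2.
  by rewrite mulrC size_mulX ?s1 // -size_poly_gt0 s1.
rewrite chebUSS size_polyDl ?size_polyN ?s0 ?sX //; split=> // _.
rewrite monicE lead_coefDl ?size_polyN ?s0 ?sX //.
by rewrite lead_coef_Mmonic // -?monicE ?monicX // m1.
Qed.

Lemma chebU_monic n : chebU n.+1 \is monic.
Proof. by apply: (size_chebU n.+1).2. Qed.

Lemma chebU_neq0 n : chebU n.+1 != 0.
Proof. exact: monic_neq0 (chebU_monic n). Qed.

(* [s^n + s^-n] as a polynomial in [s + s^-1]. *)
Definition dickson (n : nat) : {poly int} := 2%:R * chebU n.+1 - 'X * chebU n.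

(* The symmetric Gaussian binomial [n, j]; in this form of Pascal's rule, which
   comes from [chebU_add], the subtraction truncates only next to a vanishing factor. *)
Fixpoint qbin (n j : nat) : {poly int} :=
  match j, n with
  | 0, _ => 1
  | _.+1, 0 => 0
  | j'.+1, n'.+1 => chebU (n' - j').+1 * qbin n' j' - chebU j' * qbin n' j
  end.

Lemma qbinn0 n : qbin n 0 = 1.
Proof. by case: n. Qed.

Lemma qbinSS n j :
  qbin n.+1 j.+1 = chebU (n - j).+1 * qbin n j - chebU j * qbin n j.+1.
Proof. by []. Qed.

Arguments chebU : simpl never.
Arguments qbin : simpl never.

Lemma qbin_small n j : (n < j)%N -> qbin n j = 0.
Proof.
elim: n j => [|n IH] [|j] // lt_nj.
by rewrite qbinSS !IH ?mulr0 ?subr0 // ltnW.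
Qed.

Definition qfact (n : nat) : {poly int} := \prod_(i < n) chebU i.+1.

Lemma qfactS n : qfact n.+1 = qfact n * chebU n.+1.
Proof. exact: big_ord_recr. Qed.

Lemma qfact_neq0 n : qfact n != 0.
Proof. by apply/prodf_neq0 => i _; apply: chebU_neq0. Qed.

Lemma qbinn n : qbin n n = 1.
Proof.
by elim: n => // n IH; rewrite qbinSS subnn IH qbin_small // mulr0 subr0 mulr1.
Qed.

(** With a = j and b = n - j, [chebU_add] turns the recursion into the factorial formula. Kept free
    of division, it gives the absorption rules below by cancellation. *)
Lemma qbin_fact n j : (j <= n)%N -> qbin n j * (qfact j * qfact (n - j)) = qfact n.
Proof.
elim: n j => [|n IH] [|j] // le_jn.
- by rewrite qbinn0 /qfact big_ord0 !mul1r.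
- by rewrite qbinn0 subn0 {1}/qfact big_ord0 !mul1r.
move: le_jn; rewrite ltnS leq_eqVlt => /orP[/eqP->|lt_jn].
  by rewrite qbinn subnn {2}/qfact big_ord0 mulr1 mul1r.
rewrite qbinSS subSS [RHS]qfactS.
have := IH _ (ltnW lt_jn); have := IH _ lt_jn.
have [i ->] : exists i, n = (j + i).+1 by exists (n - j).-1; lia.
have -> : ((j + i).+1 - j = i.+1)%N by lia.
have -> : ((j + i).+1 - j.+1 = i)%N by lia.
rewrite (qfactS i) (qfactS j); set F := qfact (j + i).+1 => h1 h2.
have -> : (j + i).+2 = (j + i.+1).+1 by lia.
by rewrite chebU_add [RHS]mulrBr -{1}h2 -h1; ring.
Qed.

Lemma qbinSS_mul n j : chebU j.+1 * qbin n.+1 j.+1 = chebU n.+1 * qbin n j.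
Proof.
have [le_jn|lt_nj] := leqP j n; last by rewrite !qbin_small // !mulr0.
have h1 := @qbin_fact n.+1 j.+1 le_jn; have h2 := qbin_fact le_jn.
apply: (mulIf (mulf_neq0 (qfact_neq0 j) (qfact_neq0 (n - j)))).
rewrite -[RHS]mulrA h2; move: h1; rewrite subSS !qfactS => h1.
by rewrite [RHS]mulrC -h1; ring.
Qed.

Lemma qbin_mulS n j : chebU j.+1 * qbin n j.+1 = chebU (n - j) * qbin n j.
Proof.
have [lt_jn|] := ltnP j n; last first.
  rewrite leq_eqVlt => /orP[/eqP->|lt_nj].
    by rewrite subnn qbin_small // mulr0 mul0r.
  by rewrite !qbin_small ?mulr0 // ltnW.
have h1 := qbin_fact lt_jn; have := qbin_fact (ltnW lt_jn).
rewrite -[(n - j)%N]prednK ?subn_gt0 // -subnS => h2.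
apply: (mulIf (mulf_neq0 (qfact_neq0 j) (qfact_neq0 (n - j.+1)))).
transitivity (qfact n).
  by rewrite -h1 qfactS; ring.
by rewrite -h2 qfactS; ring.
Qed.

Section Laurent.
Variables (R : comNzRingType) (s si : R).
Hypothesis ssi : s * si = 1.
Let w := s + si.

(** Neither form divides by s - s^-1, so both remain valid where s = s^-1. *)
Lemma ev_chebU_both n :
  ev w (chebU n.+1) = s ^+ n + si * ev w (chebU n) /\
  ev w (chebU n.+1) = si ^+ n + s * ev w (chebU n).
Proof.
elim: n => [|n [IH1 IH2]]; first by rewrite chebU1 chebU0 !evE !mulr0 !addr0.
have e2 : ev w (chebU n.+2) = w * ev w (chebU n.+1) - ev w (chebU n).
  by rewrite chebUSS !evE.
split; rewrite e2 /w mulrDl.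
  rewrite {1}IH1 mulrDr mulrA ssi -exprS; ring.
by rewrite {2}IH2 mulrDr mulrA [si * s]mulrC ssi -exprS; ring.
Qed.

Lemma ev_chebUSl n : ev w (chebU n.+1) = s ^+ n + si * ev w (chebU n).
Proof. by case: (ev_chebU_both n). Qed.

Lemma ev_chebUSr n : ev w (chebU n.+1) = si ^+ n + s * ev w (chebU n).
Proof. by case: (ev_chebU_both n). Qed.

Lemma ev_chebU n : (s - si) * ev w (chebU n) = s ^+ n - si ^+ n.
Proof.
apply/eqP; rewrite mulrBl subr_eq addrAC -subr_eq opprK; apply/eqP.
by rewrite [LHS]addrC -ev_chebUSr ev_chebUSl.
Qed.

Lemma ev_dickson n : ev w (dickson n) = s ^+ n + si ^+ n.
Proof.
rewrite /dickson !evE.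
have -> : 2%:R * ev w (chebU n.+1) - w * ev w (chebU n) =
  (ev w (chebU n.+1) - si * ev w (chebU n)) + (ev w (chebU n.+1) - s * ev w (chebU n)).
  by rewrite /w; ring.
by rewrite {1}ev_chebUSl ev_chebUSr !addrK.
Qed.

(** The one-sided Pascal rule: once both quantum integers of the symmetric rule are expanded, the
    surplus terms cancel by [qbin_mulS]. *)
Lemma ev_qbinSS n j : ev w (qbin n.+1 j.+1) =
  s ^+ j.+1 * ev w (qbin n j.+1) + si ^+ n * s ^+ j * ev w (qbin n j).
Proof.
rewrite qbinSS !evE.
have [le_jn|lt_nj] := leqP j n; last first.
  by rewrite !qbin_small ?ev0 ?mulr0 ?subr0 ?addr0 // ltnW.
have uj : ev w (chebU j) = s * ev w (chebU j.+1) - s ^+ j.+1.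
  by rewrite ev_chebUSl mulrDr mulrA ssi mul1r -exprS addrC addKr.
have h : ev w (chebU j.+1) * ev w (qbin n j.+1)
       = ev w (chebU (n - j)) * ev w (qbin n j).
  by rewrite -!evM qbin_mulS.
have -> : si ^+ n * s ^+ j = si ^+ (n - j).
  by rewrite -{1}(subnK le_jn) exprD -mulrA -exprMn [si * s]mulrC ssi expr1n mulr1.
rewrite ev_chebUSr uj mulrBl -mulrA h; ring.
Qed.

(** The q-Vandermonde convolution, by induction on [i] with the one-sided Pascal rule. *)
Lemma ev_qbin_add n i r : ev w (qbin (n + i) r) =
  \sum_(j < r.+1) s ^+ (i * (r - j)) * si ^+ (n * j)
                  * ev w (qbin n (r - j)) * ev w (qbin i j).
Proof.
elim: i r => [|i IH] r.
  rewrite addn0 big_ord_recl big1 => [|j _].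
    by rewrite subn0 mul0n muln0 qbinn0 ev1 !mul1r mulr1 addr0.
  by rewrite /= ev0 mulr0.
case: r => [|r].
  by rewrite big_ord_recl big_ord0 !qbinn0 !muln0 ev1 !mulr1 addr0.
rewrite addnS ev_qbinSS !IH [RHS]big_ord_recl !big_distrr /=.
rewrite big_ord_recl /= -addrA; congr (_ + _).
  by rewrite !qbinn0 !subn0 !muln0 mulSn exprD; ring.
rewrite -big_split; apply: eq_bigr => j _ /=.
rewrite /bump leq0n add1n subSS ev_qbinSS mulrDr; congr (_ + _).
  have -> : s ^+ r.+1 = s ^+ (r - j) * s ^+ j.+1.
    by rewrite -exprD; congr (_ ^+ _); have := ltn_ord j; lia.
  by rewrite mulSn exprD; ring.
have -> : s ^+ r = s ^+ (r - j) * s ^+ j.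
  by rewrite -exprD; congr (_ ^+ _); have := ltn_ord j; lia.
by rewrite mulSn mulnS !exprD; ring.
Qed.

End Laurent.

(** * Lucas congruences to second order *)

Lemma chebU_casoratian n :
  chebU n.+1 ^+ 2 - 'X * chebU n * chebU n.+1 + chebU n ^+ 2 = 1.
Proof.
elim: n => [|n IH]; first by rewrite chebU1 chebU0; ring.
by rewrite chebUSS -IH; ring.
Qed.

(** This is (s^k + s^-k) {n+k} = {n+2k} + {n}. The induction carries two consecutive n because
    [chebU] obeys a recurrence of order two. *)
Lemma dickson_mul_chebU k n :
  dickson k * chebU (n + k) = chebU (n + k + k) + chebU n.
Proof.
suff: dickson k * chebU (n + k) = chebU (n + k + k) + chebU n /\
      dickson k * chebU (n + k).+1 = chebU (n + k + k).+1 + chebU n.+1 by case.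
elim: n => [|n [IH0 IH1]]; last first.
  by rewrite !addSn; split=> //; rewrite !chebUSS mulrBr mulrCA IH1 IH0; ring.
rewrite !add0n chebU1 chebU0; split; last first.
  by rewrite chebU_add -(chebU_casoratian k) /dickson; ring.
case: k => [|k]; first by rewrite addn0 chebU0 mulr0 addr0.
by rewrite addnS chebU_add /dickson !chebUSS; ring.
Qed.

(** By [dickson_mul_chebU], the values at multiples of k obey the recurrence of [chebU] with s^k +
    s^-k in place of w. *)
Lemma chebUM k a : chebU (k * a) = chebU k * (chebU a \Po dickson k).
Proof.
suff: chebU (k * a) = chebU k * (chebU a \Po dickson k) /\
      chebU (k * a.+1) = chebU k * (chebU a.+1 \Po dickson k) by case.
elim: a => [|a [IH0 IH1]].
  by rewrite muln0 muln1 chebU1 chebU0 comp_poly0 comp_polyC mulr0 mulr1.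
split=> //; rewrite chebUSS comp_polyB comp_polyM comp_polyX.
rewrite mulrBr mulrCA -IH1 -IH0 -[(k * a.+1)%N]/(k * a.+1)%N.
by rewrite !mulnS [(k + _)%N]addnC [(k + _)%N]addnC dickson_mul_chebU addrK.
Qed.

(** The value of {n}/{1} at s = s^-1 = sg, where the quotient itself degenerates. *)
Lemma ev_chebU_double (R : comNzRingType) (sg : R) n : sg * sg = 1 ->
  ev (sg + sg) (chebU n) = n%:R * sg ^+ n.-1.
Proof.
move=> sg2; case: n => [|n]; first by rewrite chebU0 ev0 mul0r.
elim: n => [|n IH]; first by rewrite chebU1 ev1 mulr1.
by rewrite ev_chebUSl // IH [in RHS]mulrSr mulrDl mul1r [RHS]addrC exprS; ring.
Qed.

(* The coefficient of [a^(n/2 - j)] in [{n}^2 Z_n], for [tau > 0]. *)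
Definition lmov_coef (tau n j : nat) : {poly int} :=
  (-1) ^+ (n * tau + j) * (qbin n j * qbin (n * tau + n - j).-1 n.-1).

Section DualLucas.
Variables (D : comNzRingType) (e : D).
Hypothesis e2 : e * e = 0.
Hypothesis nat_inv : forall n, (0 < n)%N -> exists y : D, y * n%:R = 1.

Lemma dual_expr (c : D) m : (1 + c * e) ^+ m = 1 + m%:R * c * e.
Proof.
elim: m => [|m IH]; first by rewrite expr0 !mul0r addr0.
rewrite exprS IH mulrSr.
have -> : (1 + c * e) * (1 + m%:R * c * e) =
  1 + (m%:R + 1) * c * e + m%:R * c * c * (e * e) by ring.
by rewrite e2 mulr0 addr0.
Qed.

Lemma sign_expr (sg : D) a b : sg * sg = 1 -> odd a = odd b -> sg ^+ a = sg ^+ b.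
Proof.
move=> sg2 ab; rewrite -(odd_double_half a) -(odd_double_half b) ab !exprD.
by rewrite -!muln2 ![(_ * 2)%N]mulnC !exprM !expr2 sg2 !expr1n.
Qed.

(* [s] is an infinitesimal thickening of a point [s0] with [s0^k = sg] and
   [sg^2 = 1] at which the quantum integers [{n}] with [k] not dividing [n] survive. *)
Definition thick (k : nat) (sg s si : D) : Prop :=
  [/\ s * si = 1, sg * sg = 1,
      exists c, s ^+ k = sg * (1 + c * e) /\ si ^+ k = sg * (1 - c * e) &
      forall n, ~~ (k %| n)%N -> exists y, y * (s ^+ n - si ^+ n) = 1].

Section Thick.
Variables (k : nat) (sg s si : D).
Hypothesis k_gt0 : (0 < k)%N.
Hypothesis s_thick : thick k sg s si.
Let w := s + si.

Lemma thick_dvd n : (k %| n)%N -> exists y, s ^+ n - si ^+ n = e * y.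
Proof.
have [_ _ [c [sk sik]] _] := s_thick.
case/dvdnP=> a ->; exists (sg ^+ a * ((a%:R * c) + (a%:R * c))).
rewrite mulnC !exprM sk sik !exprMn.
have -> : 1 - c * e = 1 + (- c) * e by ring.
by rewrite !dual_expr; ring.
Qed.

Lemma thick_chebU n : (s - si) * ev w (chebU n) = s ^+ n - si ^+ n.
Proof. by case: s_thick => ssi _ _ _; apply: ev_chebU. Qed.

(** In {j} [n, j] = {n} [n-1, j-1] the factor {j} is a unit, while {n} lies in the ideal (e). *)
Lemma qbin_mid n j : (k %| n)%N -> ~~ (k %| j)%N ->
  exists y, ev w (qbin n j) = e * y.
Proof.
move=> kn kj; case: j kj => [|j] kj; first by rewrite dvdn0 in kj.
case: n kn => [|n] kn; first by exists 0; rewrite mulr0 -(ev0 w).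
have [_ _ _ inv] := s_thick.
have [y yP] := inv _ kj; have [x xP] := thick_dvd kn.
exists (y * (x * ev w (qbin n j))).
rewrite -[LHS]mul1r -yP -thick_chebU.
have -> : y * ((s - si) * ev w (chebU j.+1)) * ev w (qbin n.+1 j.+1) =
  y * ((s - si) * ev w (chebU j.+1 * qbin n.+1 j.+1)) by rewrite evM; ring.
by rewrite qbinSS_mul evM [(s - si) * _]mulrA thick_chebU xP; ring.
Qed.

(* In the Vandermonde sum for [k a + k] all terms but two have both factors in
   the ideal [(e)], so the q-Pascal rule for [q^(k^2)] remains; the terms in [e] of
   its two summands cancel. *)
Lemma qbin_lucas a b : (b <= a)%N ->
  ev w (qbin (k * a) (k * b)) = sg ^+ (k * (b * (a - b))) * 'C(a, b)%:R.
Proof.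
have [ssi sg2 [c [sk sik]] _] := s_thick.
elim: a b => [|a IH] [|b] // le_ba; rewrite ?muln0 ?qbinn0 ?mul0n ?muln0 ?ev1 ?bin0 ?mulr1 //.
have sX m : s ^+ (k * m) = sg ^+ m * (1 + m%:R * c * e).
  by rewrite exprM sk exprMn dual_expr.
have siX m : si ^+ (k * m) = sg ^+ m * (1 - m%:R * c * e).
  rewrite exprM sik exprMn (_ : 1 - c * e = 1 + (- c) * e) ?dual_expr; ring.
rewrite [(k * a.+1)%N]mulnS addnC (ev_qbin_add ssi) -/w.
have lt0 : (0 < (k * b.+1).+1)%N by [].
have ltk : (k < (k * b.+1).+1)%N by rewrite ltnS leq_pmulr.
rewrite (bigD1 (Ordinal lt0)) //= (bigD1 (Ordinal ltk)) /=; last by rewrite -val_eqE -lt0n.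
rewrite big1 => [|j]; last first.
  rewrite -!val_eqE /= => /andP[j0 jk].
  have [lt_kj|] := ltnP k j; first by rewrite [qbin k j]qbin_small // ev0 mulr0.
  rewrite leq_eqVlt (negPf jk) /= => lt_jk.
  have kj : ~~ (k %| j)%N by rewrite gtnNdvd // lt0n.
  have kj' : ~~ (k %| k * b.+1 - j)%N.
    by rewrite dvdn_subr ?dvdn_mulr // -ltnS ltn_ord.
  have [y ->] := qbin_mid (dvdnn k) kj.
  have [x ->] := qbin_mid (dvdn_mulr a (dvdnn k)) kj'.
  rewrite (_ : _ * (e * x) * (e * y) = s ^+ (k * (k * b.+1 - j)) * si ^+ (k * a * j) * x * y * (e * e)); last ring.
  by rewrite e2 mulr0.
rewrite addr0 subn0 muln0 expr0 mulr1 qbinn0 qbinn !ev1 !mulr1.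
have -> : (k * b.+1 - k = k * b)%N by rewrite mulnS addKn.
rewrite -[(k * a * k)%N]mulnA sX siX.
rewrite sX (IH b) //.
(* This identity makes the terms in [e] cancel: the two summands contribute k (b + 1) C(a, b + 1) c
   and k (b - a) C(a, b) c. *)
have hb : (b.+1 * 'C(a, b.+1) = (a - b) * 'C(a, b))%N by rewrite -mul_bin_left.
have par1 : sg ^+ (k * b.+1) * sg ^+ (k * (b.+1 * (a - b.+1))) * 'C(a, b.+1)%:R
   = sg ^+ (k * (b.+1 * (a.+1 - b.+1))) * 'C(a, b.+1)%:R.
  have [lt_ba|le_ab] := ltnP b a; last by rewrite bin_small ?mulr0.
  rewrite -exprD; congr (_ ^+ _ * _); rewrite subSS.
  have -> : (a - b = (a - b.+1).+1)%N by lia.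
  by rewrite -mulnDr -mulnS.
have -> : ev w (qbin (k * a) (k * b.+1)) = sg ^+ (k * (b.+1 * (a - b.+1))) * 'C(a, b.+1)%:R.
  have [lt_ba|le_ab] := ltnP b a; first exact: IH.
  by rewrite bin_small // qbin_small ?ev0 ?mulr0 // ltn_mul2l k_gt0.
have par2 : sg ^+ (k * b) * sg ^+ (a * k) * sg ^+ (k * (b * (a - b)))
   = sg ^+ (k * (b.+1 * (a.+1 - b.+1))).
  rewrite -!exprD; apply: sign_expr => //; rewrite subSS.
  rewrite -{1}(subnK (n := a) (m := b)) // !oddD !oddM !oddD !oddS.
  by case: (odd k); case: (odd b); case: (odd (a - b)).
have -> : sg ^+ (k * b.+1) * (1 + (k * b.+1)%:R * c * e) *
   (sg ^+ (k * (b.+1 * (a - b.+1))) * 'C(a, b.+1)%:R) =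
   sg ^+ (k * (b.+1 * (a.+1 - b.+1))) * ('C(a, b.+1)%:R + k%:R * (b.+1 * 'C(a, b.+1))%:R * c * e).
  transitivity (sg ^+ (k * b.+1) * sg ^+ (k * (b.+1 * (a - b.+1))) * 'C(a, b.+1)%:R
    * (1 + (k * b.+1)%:R * c * e)); first by ring.
  by rewrite par1 !natrM; ring.
rewrite binS natrD mulrDr -par2 hb !natrM.
have ee : (1 + k%:R * b%:R * c * e) * (1 - a%:R * k%:R * c * e) =
    1 + k%:R * (b%:R - a%:R) * c * e.
  transitivity (1 + k%:R * (b%:R - a%:R) * c * e
    - (k%:R * b%:R * a%:R * k%:R * c * c) * (e * e)); first by ring.
  by rewrite e2 mulr0 subr0.
by rewrite natrB // [sg ^+ (k * b) * _ * (_ * _)]mulrACA ee; ring.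
Qed.

(** Both Gaussian factors lie in (e): the first by [qbin_mid], the second because {A} [A-1, n-1] =
    {n} [A, n], where k does not divide A = n tau + n - j. *)
Lemma lmov_coef_mid tau n j : (0 < n)%N -> (j <= n)%N ->
  (k %| n)%N -> ~~ (k %| j)%N -> ev w (lmov_coef tau n j) = 0.
Proof.
move=> n_gt0 le_jn kn kj; have [_ _ _ inv] := s_thick.
rewrite /lmov_coef !evM; have [x ->] := qbin_mid kn kj.
set A := (n * tau + n - j)%N.
have kA : ~~ (k %| A)%N.
  rewrite /A dvdn_subr ?leq_addr // ?dvdn_add ?dvdn_mulr //.
  by rewrite (leq_trans le_jn) ?leq_addl.
have A_gt0 : (0 < A)%N by case: (A) kA => //; rewrite dvdn0.
have [y yP] := inv _ kA; have [z zP] := thick_dvd kn.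
have -> : ev w (qbin A.-1 n.-1) = e * (y * z * ev w (qbin A n)).
  rewrite -[LHS]mul1r -yP -thick_chebU.
  rewrite -[in RHS](prednK A_gt0) -[in RHS](prednK n_gt0).
  have -> : y * ((s - si) * ev w (chebU A)) * ev w (qbin A.-1 n.-1) =
    y * ((s - si) * ev w (chebU A * qbin A.-1 n.-1)) by rewrite evM; ring.
  rewrite -[in chebU A](prednK A_gt0) -qbinSS_mul evM [(s - si) * _]mulrA.
  by rewrite thick_chebU (prednK n_gt0) zP; ring.
by rewrite [e * x * _]mulrACA e2 mul0r mulr0.
Qed.

(** The factor A = a tau + a - b on the left clears the quotient {ka}/{kA}, whose value is a/A up to
    sign. Only the last sign on the right involves k, so the values for k and for k/p can be
    compared. *)
Lemma lmov_coef_lucas tau a b : (0 < a)%N -> (b <= a)%N -> (0 < tau)%N ->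
  (a * tau + a - b)%:R * ev w (lmov_coef tau (k * a) (k * b)) =
  sg ^+ (tau * a + b) * (a * ('C(a, b) * 'C(a * tau + a - b, a)))%:R
    * (- sg) ^+ (k * (a * tau + b)).
Proof.
move=> a_gt0 le_ba tau_gt0; have [ssi sg2 [c [sk sik]] _] := s_thick.
set A := (a * tau + a - b)%N.
have le_aA : (a <= A)%N by rewrite /A; have := @leq_pmulr a tau tau_gt0; lia.
have A_gt0 := leq_trans a_gt0 le_aA.
have ev2 : ev w (dickson k) = sg + sg by rewrite ev_dickson // sk sik; ring.
(* The factor [chebU k] has to be cancelled before evaluation, since for k > 1 its value lies in
   (e). *)
have key : (chebU A \Po dickson k) * qbin (k * A).-1 (k * a).-1 =
           (chebU a \Po dickson k) * qbin (k * A) (k * a).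
  apply: (mulfI (chebU_neq0 k.-1)); rewrite (prednK k_gt0) !mulrA -!chebUM.
  have kA_gt0 : (0 < k * A)%N by rewrite muln_gt0 k_gt0.
  have ka_gt0 : (0 < k * a)%N by rewrite muln_gt0 k_gt0.
  by have := qbinSS_mul (k * A).-1 (k * a).-1; rewrite !prednK.
have := congr1 (ev w) key; rewrite !evM !ev_comp ev2.
rewrite !ev_chebU_double // qbin_lucas // => key2.
rewrite /lmov_coef.
have -> : (k * a * tau + k * a - k * b = k * A)%N by rewrite -mulnA -mulnDr -mulnBr.
rewrite qbin_lucas //.
have -> : ev w ((-1) ^+ (k * a * tau + k * b)) = (-1) ^+ (k * (a * tau + b)).
  by rewrite rmorphXn /= evN ev1 mulnDr mulnA.
have sgA : sg ^+ A.-1 * sg ^+ A.-1 = 1 by rewrite -exprMn sg2 expr1n.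
transitivity ((-1) ^+ (k * (a * tau + b)) * (sg ^+ (k * (b * (a - b))) * 'C(a, b)%:R) *
  sg ^+ A.-1 * (A%:R * sg ^+ A.-1 * ev w (qbin (k * A).-1 (k * a).-1))).
  by rewrite -[LHS]mul1r -sgA; ring.
rewrite key2 [(- sg) ^+ _]exprNn !natrM.
have sgE : sg ^+ (tau * a + b) * sg ^+ (k * (a * tau + b)) =
 sg ^+ (k * (b * (a - b))) * sg ^+ A.-1 * sg ^+ a.-1 * sg ^+ (k * (a * (A - a))).
  rewrite -!exprD; apply: sign_expr => //.
  have oA : odd A.-1 = ~~ odd (a * tau + (a - b)) by rewrite addnBA // -/A -[in RHS](prednK A_gt0) /= negbK.
  have oa : odd a.-1 = ~~ odd a by rewrite -[in RHS](prednK a_gt0) /= negbK.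
  have -> : (A - a = a * tau - b)%N by rewrite /A; lia.
  have le_bat : (b <= a * tau)%N by rewrite (leq_trans le_ba) // leq_pmulr.
  rewrite !oddD oA oa !oddD !oddM (oddB le_bat) !(oddB le_ba) !oddD !oddM.
  by case: (odd k); case: (odd b); case: (odd a); case: (odd tau).
transitivity ((a%:R * ('C(a, b)%:R * 'C(A, a)%:R)) * (-1) ^+ (k * (a * tau + b)) *
  (sg ^+ (k * (b * (a - b))) * sg ^+ A.-1 * sg ^+ a.-1 * sg ^+ (k * (a * (A - a))))).
  by ring.
by rewrite -sgE; ring.
Qed.

End Thick.
End DualLucas.

(** * Moebius sums over divisors and their cancellation in pairs *)

Lemma primes_prime_mul p n : prime p -> (0 < n)%N -> ~~ (p %| n)%N ->
  perm_eq (primes (p * n)) (p :: primes n).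
Proof.
move=> p_pr n_gt0 pn; apply: uniq_perm; rewrite ?primes_uniq //=.
  by rewrite primes_uniq mem_primes (negPf pn) !andbF.
by move=> q; rewrite primesM ?(prime_gt0 p_pr) ?n_gt0 ?(primes_prime p_pr) ?in_cons ?orbF.
Qed.

Lemma mobius_prime_mul p n : prime p -> (0 < n)%N ->
  mobius (p * n) = if (p %| n)%N then 0 else - mobius n.
Proof.
move=> p_pr n_gt0; have p_gt0 := prime_gt0 p_pr; rewrite /mobius.
rewrite muln_eq0 !eqn0Ngt p_gt0 n_gt0 /=.
have lg q : logn q (p * n) = ((q == p) + logn q n)%N.
  by rewrite lognM // logn_prime.
case: (boolP (p %| n)%N) => pn.
  case: ifPn => // /allP allp; have := allp p.
  rewrite mem_primes p_pr muln_gt0 p_gt0 n_gt0 dvdn_mulr //= => /(_ isT).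
  rewrite lg eqxx add1n eqSS => /eqP lg0.
  by move: (pn); rewrite -(expn1 p) pfactor_dvdn // lg0.
have P := primes_prime_mul p_pr n_gt0 pn.
rewrite (perm_all _ P) (perm_size P) /= lg eqxx lognE (negPf pn) !andbF /= exprS.
have -> : all (fun q => logn q (p * n) == 1%N) (primes n) =
          all (fun q => logn q n == 1%N) (primes n).
  apply: eq_in_all => q; rewrite mem_primes => /and3P[_ _ qn].
  by rewrite lg; case: (q =P p) => // qp; rewrite -qp qn in pn.
by case: ifP => _; rewrite ?mulN1r ?oppr0.
Qed.

(** Divisors divisible by p^2 drop out. The others divisible by p are the p d with d prime to p;
    they carry the opposite sign of d, and all of them divide m because p does. *)
Lemma mobius_sum_prime (R : pzRingType) (f : nat -> R) m p :
  prime p -> (p %| m)%N -> (0 < m)%N ->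
  \sum_(d <- divisors m) (mobius d)%:~R * f d =
  \sum_(d <- divisors m | ~~ (p %| d)%N) (mobius d)%:~R * (f d - f (p * d)%N).
Proof.
move=> p_pr pm m_gt0; have p_gt0 := prime_gt0 p_pr.
rewrite (bigID (fun d => (p %| d)%N)) /= addrC.
under [RHS]eq_bigr do rewrite mulrBr; rewrite sumrB; congr (_ + _).
rewrite (bigID (fun d => (p %| d %/ p)%N)) /= big1_seq ?add0r => [|d]; last first.
  rewrite -dvdn_divisors // => /andP[/andP[pd pdp] dm].
  have d_gt0 := dvdn_gt0 m_gt0 dm.
  rewrite -(divnK pd) mulnC mobius_prime_mul ?pdp ?mul0r //.
  by rewrite divn_gt0 // dvdn_leq.
rewrite -sumrN -big_filter -[RHS]big_filter.
rewrite (perm_big [seq (p * d)%N | d <- [seq d <- divisors m | ~~ (p %| d)%N]]) /=.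
  rewrite big_map !big_filter [RHS]big_seq_cond [LHS]big_seq_cond.
  apply: eq_bigr => d; rewrite -dvdn_divisors // => /andP[dm pd].
  by rewrite mobius_prime_mul ?(dvdn_gt0 m_gt0 dm) // (negPf pd) rmorphN mulNr.
apply: uniq_perm; rewrite ?filter_uniq ?divisors_uniq //.
  rewrite map_inj_in_uniq ?filter_uniq ?divisors_uniq // => x y _ _ /eqP.
  by rewrite eqn_pmul2l // => /eqP.
move=> d; rewrite mem_filter -dvdn_divisors //; apply/idP/mapP.
  move=> /andP[/andP[pd pdp] dm]; exists (d %/ p)%N; last by rewrite mulnC divnK.
  by rewrite mem_filter pdp -dvdn_divisors // (dvdn_trans (dvdn_div pd)).
case=> x; rewrite mem_filter -dvdn_divisors // => /andP[px xm] ->.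
rewrite dvdn_mulr // mulKn // px /= Gauss_dvd ?pm //.
by rewrite prime_coprime.
Qed.

Section LmovPrime.
Variables (D : comNzRingType) (e : D).
Hypothesis e2 : e * e = 0.
Hypothesis nat_inv : forall n, (0 < n)%N -> exists y : D, y * n%:R = 1.
Variables (k : nat) (sg s si : D).
Hypothesis k_gt0 : (0 < k)%N.
Hypothesis s_thick : thick e k sg s si.

(** Passing from s to s^p keeps [sg] and [c], as the power k/p of s^p is s^k. *)
Lemma thick_div p : (p %| k)%N -> thick e (k %/ p) sg (s ^+ p) (si ^+ p).
Proof.
move=> pk; have p_gt0 := dvdn_gt0 k_gt0 pk; have [ssi sg2 [c [sk sik]] inv] := s_thick.
split=> //; first by rewrite -exprMn ssi expr1n.
  by exists c; rewrite -!exprM mulnC divnK.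
move=> n kn; have [|y yP] := inv (p * n)%N.
  by apply: contra kn => kn; rewrite -(dvdn_pmul2l p_gt0) [(p * (k %/ p))%N]mulnC divnK.
by exists y; rewrite -!exprM.
Qed.

(** If k does not divide j, both sides vanish. Otherwise [lmov_coef_lucas] evaluates both with the
    same a and b, and they differ only in (- sg)^k against (- sg)^(k/p). These agree if sg = -1, and
    also for k odd, since then k/p is odd too. *)
Lemma lmov_coef_prime tau n j p : odd k \/ sg = -1 ->
    prime p -> (p %| k)%N -> (k %| n)%N ->
    (0 < n)%N -> (j <= n)%N -> (0 < tau)%N ->
  ev (s + si) (lmov_coef tau n j) =
  if (p %| j)%N then ev (s ^+ p + si ^+ p) (lmov_coef tau (n %/ p) (j %/ p)) else 0.
Proof.
move=> sgN p_pr pk kn n_gt0 le_jn tau_gt0; have p_gt0 := prime_gt0 p_pr.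
have thp := thick_div pk; set k1 := (k %/ p)%N in thp.
have k1_gt0 : (0 < k1)%N by rewrite divn_gt0 // dvdn_leq.
have kE : k = (k1 * p)%N by rewrite divnK.
have [[b jE]|kj] := @dvdnP k j; last first.
  have {}kj : ~~ (k %| j)%N by apply/dvdnP => -[b jb]; apply: kj; exists b.
  rewrite (lmov_coef_mid e2 s_thick) //; case: ifPn => // pj.
  rewrite (lmov_coef_mid e2 thp) //.
  - by rewrite divn_gt0 // dvdn_leq // (dvdn_trans pk).
  - exact: leq_div2r.
  - by rewrite -(dvdn_pmul2r p_gt0) !divnK // (dvdn_trans pk).
  - by apply: contra kj; rewrite -(dvdn_pmul2r p_gt0) !divnK.
case/dvdnP: (kn) => a nE.
have nE1 : n = (k * a)%N by rewrite mulnC.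
have jE1 : j = (k * b)%N by rewrite mulnC.
have a_gt0 : (0 < a)%N by move: n_gt0; rewrite nE muln_gt0 => /andP[].
have le_ba : (b <= a)%N by move: le_jn; rewrite nE jE leq_pmul2r.
have np : (n %/ p = k1 * a)%N by rewrite nE1 kE mulnAC mulnK.
have jp : (j %/ p = k1 * b)%N by rewrite jE1 kE mulnAC mulnK.
have -> : (p %| j)%N by rewrite (dvdn_trans pk) // jE1 dvdn_mulr.
have A_gt0 : (0 < a * tau + a - b)%N.
  by have := @leq_pmulr a tau tau_gt0; lia.
have [y yA] := nat_inv A_gt0.
rewrite np jp nE1 jE1 -[LHS]mul1r -[RHS]mul1r -yA -!mulrA.
rewrite (lmov_coef_lucas e2 k_gt0 s_thick) // (lmov_coef_lucas e2 k1_gt0 thp) //.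
congr (_ * (_ * _)); rewrite !exprM; congr (_ ^+ _).
have [_ sg2 _ _] := s_thick.
case: sgN => [k_odd|->]; last by rewrite opprK !expr1n.
apply: sign_expr; rewrite ?mulrNN // k_odd; move: k_odd.
by rewrite kE oddM => /andP[-> _].
Qed.
End LmovPrime.

(* Dual numbers [L[e]/(e^2)], the pair [(a, b)] standing for [a + b e]. *)
Definition dual (L : Type) := (L * L)%type.

Section Dual.
Variable L : fieldType.
HB.instance Definition _ := GRing.Zmodule.copy (dual L) (L * L)%type.

Definition dual_one : dual L := (1, 0).
Definition dual_mul (x y : dual L) : dual L := (x.1 * y.1, x.1 * y.2 + x.2 * y.1).

Lemma dual_mulA : associative dual_mul.
Proof. by move=> [a b] [c d] [f g]; congr pair => /=; ring. Qed.
Lemma dual_mulC : commutative dual_mul.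
Proof. by move=> [a b] [c d]; congr pair => /=; ring. Qed.
Lemma dual_mul1 : left_id dual_one dual_mul.
Proof. by move=> [a b]; congr pair => /=; ring. Qed.
Lemma dual_mulD : left_distributive dual_mul +%R.
Proof. by move=> [a b] [c d] [f g]; congr pair => /=; ring. Qed.
Lemma dual_one_neq0 : dual_one != 0.
Proof. by apply/eqP => -[/eqP]; rewrite oner_eq0. Qed.

HB.instance Definition _ := GRing.Zmodule_isComNzRing.Build (dual L)
  dual_mulA dual_mulC dual_mul1 dual_mulD dual_one_neq0.

Lemma dualM (x y : dual L) : x * y = (x.1 * y.1, x.1 * y.2 + x.2 * y.1).
Proof. by []. Qed.
Lemma dualD (x y : dual L) : x + y = (x.1 + y.1, x.2 + y.2).
Proof. by []. Qed.
Lemma dualN (x : dual L) : - x = (- x.1, - x.2).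
Proof. by []. Qed.
Lemma dual1 : 1 = (1, 0) :> dual L.
Proof. by []. Qed.
Lemma dual0 : 0 = (0, 0) :> dual L.
Proof. by []. Qed.
Lemma dual_nat n : n%:R = (n%:R, 0) :> dual L.
Proof. by elim: n => // n IH; rewrite !mulrS IH dual1 dualD /= addr0. Qed.

Lemma dual_int (n : int) : n%:~R = (n%:~R, 0) :> dual L.
Proof.
case: n => n; first exact: dual_nat.
by rewrite NegzE !mulrNz -!pmulrn dual_nat dualN oppr0.
Qed.

(** First-order Taylor expansion: vanishing at a dual number with nonzero second component means a
    double root at the first. *)
Lemma ev_dual (w : dual L) P :
  ev w P = (ev w.1 P, (map_poly intr P)^`().[w.1] * w.2).
Proof.
elim/poly_ind: P => [|P c IH]; first by rewrite !ev0 rmorph0 deriv0 horner0 mul0r.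
have evC (R : comNzRingType) (x : R) : ev x c%:P = c%:~R by rewrite /ev map_polyC hornerC.
rewrite evD evM evX evC IH dual_int dualM dualD /= evD evM evX evC.
congr pair; rewrite rmorphD rmorphM /= map_polyX map_polyC derivD derivM derivX derivC.
by rewrite hornerD hornerD !hornerM hornerX !hornerC /ev; ring.
Qed.
End Dual.

(** * Divisibility of the Moebius sums *)

(* The coefficient of [a^(m/2 - j)] in [{m}^2 g_m], for [tau > 0]; composing with
   [dickson d] is the substitution [q -> q^d]. *)
Definition lmov_poly (tau m j : nat) : {poly int} :=
  \sum_(d <- divisors m) (mobius d)%:~R *
    (if (d %| j)%N then lmov_coef tau (m %/ d) (j %/ d) \Po dickson d else 0).

Section DualPoint.
Variable L : numFieldType.

Definition dual_eps : dual L := (0, 1).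
(* The point [z (1 + c e)], so that powers act by [(z, c) -> (z^n, n c)]. *)
Definition dual_pt (z c : L) : dual L := (z, c * z).

Lemma dual_eps2 : dual_eps * dual_eps = 0.
Proof. by rewrite dualM /= !mul0r mulr0 addr0. Qed.

Lemma dual_nat_inv n : (0 < n)%N -> exists y : dual L, y * n%:R = 1.
Proof.
move=> n_gt0; exists (n%:R^-1, 0).
by rewrite dual_nat dualM /= mulr0 mul0r addr0 mulVf // pnatr_eq0 -lt0n.
Qed.

Lemma dual_ptX z c n : dual_pt z c ^+ n = dual_pt (z ^+ n) (n%:R * c).
Proof.
elim: n => [|n IH]; first by rewrite expr0 /dual_pt !mul0r.
by rewrite exprS IH dualM /dual_pt exprS mulrSr; congr pair => /=; ring.
Qed.

(** Here [sg] is z^k, a sign since z^2 has order k. For k even it is -1, as z^k = 1 would make the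
    order of z^2 divide k/2. *)
Lemma dual_pt_thick z c k : k.-primitive_root (z ^+ 2) ->
  exists2 sg, thick dual_eps k sg (dual_pt z c) (dual_pt z^-1 (- c))
            & odd k \/ sg = -1.
Proof.
move=> kz; have z_neq0 : z != 0.
  apply/eqP => z0; have /eqP := prim_expr_order kz.
  by rewrite z0 !expr0n (gtn_eqF (prim_order_gt0 kz)) eq_sym oner_eq0.
have zk2 : (z ^+ k) ^+ 2 = 1 by rewrite exprAC prim_expr_order.
have zk : z ^+ k = 1 \/ z ^+ k = -1.
  by move/eqP: zk2; rewrite sqrf_eq1 => /orP[/eqP|/eqP]; [left|right].
have zVk : z^-1 ^+ k = z ^+ k.
  by rewrite exprVn; case: zk => ->; rewrite ?invrN invr1.
exists (z ^+ k, 0); last first.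
  have [|k_even] := boolP (odd k); [by left | right].
  case: zk => zk; last by rewrite zk; congr pair; rewrite /= oppr0.
  have := odd_double_half k; rewrite (negPf k_even) add0n => kE.
  have : (z ^+ 2) ^+ k./2 = 1 by rewrite -exprM mul2n kE.
  move/eqP; rewrite -(prim_order_dvd kz) => /dvdn_leq.
  have k_gt0 := prim_order_gt0 kz.
  by move: kE k_gt0; lia.
split.
- by rewrite dualM /dual_pt /= mulfV //; congr pair; field.
- by rewrite dualM /= mulr0 mul0r addr0 -expr2 zk2.
- exists (k%:R * c, 0); rewrite !dual_ptX zVk.
  by rewrite /dual_pt !(dualM, dual1, dualD, dualN) /=; split; congr pair; ring.
move=> n kn; rewrite !dual_ptX /dual_pt.
set x := (_ - _).
have x1 : x.1 != 0.
  rewrite /x /= subr_eq0; apply: contra kn => /eqP zn.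
  by rewrite (prim_order_dvd kz) exprAC expr2 {1}zn -exprMn mulVf // expr1n.
exists (x.1^-1, - x.2 / (x.1 ^+ 2)); rewrite dualM /= mulVf //.
by congr pair; field.
Qed.

(** For a prime p dividing k, the summands of d and p d cancel by [lmov_coef_prime], applied at the
    point s^d. *)
Lemma lmov_poly_dual tau m j k z c : k.-primitive_root (z ^+ 2) -> (k %| m)%N ->
    (1 < k)%N -> (0 < m)%N -> (j <= m)%N -> (0 < tau)%N ->
  ev (dual_pt z c + dual_pt z^-1 (- c)) (lmov_poly tau m j) = 0.
Proof.
move=> kz km k_gt1 m_gt0 le_jm tau_gt0.
set s := dual_pt z c; set si := dual_pt z^-1 (- c).
have [sg [ssi _ _ _] _] := dual_pt_thick c kz.
pose f d := if (d %| j)%N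
  then ev (s ^+ d + si ^+ d) (lmov_coef tau (m %/ d) (j %/ d)) else 0.
have -> : ev (s + si) (lmov_poly tau m j) =
          \sum_(d <- divisors m) (mobius d)%:~R * f d.
  rewrite /lmov_poly rmorph_sum; apply: eq_bigr => d _; rewrite /= evM rmorph_int /f.
  by case: ifP => _; rewrite ?ev0 // ev_comp ev_dickson.
have p_pr := pdiv_prime k_gt1; have pk := pdiv_dvd k; set p := pdiv k in p_pr pk.
rewrite (mobius_sum_prime _ p_pr) ?(dvdn_trans pk) //.
rewrite big_seq_cond big1 // => d /andP[]; rewrite -dvdn_divisors // => dm pd.
have d_gt0 := dvdn_gt0 m_gt0 dm.
suff -> : f d = f (p * d)%N by rewrite subrr mulr0.
rewrite /f; case: ifPn => dj; last first.
  by case: ifPn => // pdj; rewrite (dvdn_trans _ pdj) ?dvdn_mull // in dj.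
(* The square of z^d has order k1 = k / gcd(d, k). It is still divisible by p because d is not, and
   it divides m/d because k1 d = lcm(d, k) divides m. *)
have kzd := exp_prim_root kz d; rewrite exprAC in kzd; set k1 := (k %/ _)%N in kzd.
have [sgd thd sgdN] := dual_pt_thick (d%:R * c) kzd.
have k1_gt0 := prim_order_gt0 kzd.
have k1E : (k1 * gcdn d k = k)%N by rewrite divnK // dvdn_gcdr.
have pk1 : (p %| k1)%N.
  move: pk; rewrite -k1E Euclid_dvdM // => /orP[//|].
  by rewrite dvdn_gcd (negPf pd).
have k1md : (k1 %| m %/ d)%N.
  rewrite -(dvdn_pmul2r d_gt0) divnK //.
  suff -> : (k1 * d = lcmn d k)%N by rewrite dvdn_lcm dm.
  by rewrite /lcmn -[X in (d * X)%N]k1E mulnA mulnK 1?mulnC // gcdn_gt0 d_gt0.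
have := lmov_coef_prime dual_eps2 dual_nat_inv k1_gt0 thd sgdN p_pr pk1 k1md.
move=> /(_ tau (j %/ d)%N); rewrite divn_gt0 // dvdn_leq // leq_div2r // tau_gt0.
rewrite /s /si !dual_ptX !exprVn !mulrN => -> //.
rewrite -(dvdn_pmul2r d_gt0) (divnK dj).
by rewrite -!divnMA -!exprM mulrA -natrM [(d * p)%N]mulnC.
Qed.

End DualPoint.

Lemma dvdp_sqr_XsubC (F : fieldType) (P : {poly F}) (a : F) :
  P.[a] = 0 -> P^`().[a] = 0 -> ('X - a%:P) ^+ 2 %| P.
Proof.
move=> /rootP; rewrite root_factor_theorem => /dvdpP[Q ->].
rewrite derivM hornerD !hornerM derivXsubC hornerXsubC subrr mulr0 add0r hornerC mulr1.
by move=> /rootP; rewrite root_factor_theorem expr2 => Qa; apply: dvdp_mul.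
Qed.

Lemma dvdp_sqr_prod_XsubC (F : fieldType) (P : {poly F}) (r : seq F) : uniq r ->
  (forall a, a \in r -> ('X - a%:P) ^+ 2 %| P) ->
  (\prod_(a <- r) ('X - a%:P)) ^+ 2 %| P.
Proof.
elim: r => [|a r IH] /=; first by rewrite big_nil expr1n dvd1p.
move=> /andP[ar r_uniq] rP; rewrite big_cons exprMn Gauss_dvdp.
  by rewrite rP ?mem_head // IH // => b br; rewrite rP // inE br orbT.
by rewrite coprimep_expl // coprimep_expr // coprimep_sym coprimep_XsubC root_prod_XsubC.
Qed.

(** Division by the monic Q takes place over Z; its remainder is divisible by Q over [algC] and of
    smaller degree, hence zero. *)
Lemma dvdp_monic_int (P Q : {poly int}) : Q \is monic ->
  map_poly intr Q %| map_poly (intr : int -> algC) P -> exists R, P = R * Q.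
Proof.
move=> Q_mon QP; have PE := Pdiv.RingMonic.rdivp_eq Q_mon P.
exists (Pdiv.Ring.rdivp P Q); rewrite {1}PE.
suff -> : Pdiv.Ring.rmodp P Q = 0 by rewrite addr0.
apply/eqP; apply: contraTT QP => r_neq0.
rewrite PE rmorphD rmorphM /= dvdp_addr ?dvdp_mull //.
apply/negP => /dvdp_leq.
rewrite -size_poly_eq0 !(size_map_inj_poly (@intr_inj _)) // size_poly_eq0 => /(_ r_neq0).
by rewrite leqNgt Pdiv.Ring.ltn_rmodpN0 ?monic_neq0.
Qed.

(** With zeta of order 2m, the polynomial [chebU m] has the m - 1 simple roots zeta^i + zeta^-i for
    0 < i < m. Each of them is shown to be a double root of [lmov_poly]. *)
Lemma chebU_sqr_dvd_lmov_poly tau m j : (0 < m)%N -> (j <= m)%N -> (0 < tau)%N ->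
  exists R, lmov_poly tau m j = R * chebU m ^+ 2.
Proof.
move=> m_gt0 le_jm tau_gt0; have m2_gt0 : (0 < 2 * m)%N by lia.
apply: dvdp_monic_int.
  by case: m m_gt0 {le_jm m2_gt0} => // m _; rewrite monic_exp // chebU_monic.
have [zeta zetaP] := C_prim_root_exists m2_gt0.
have zeta_neq0 : zeta != 0.
  apply/eqP => z0; have /eqP := prim_expr_order zetaP.
  by rewrite z0 !expr0n (gtn_eqF m2_gt0) eq_sym oner_eq0.
pose r := [seq zeta ^+ i + zeta ^- i | i <- iota 1 m.-1].
have zV i : zeta ^+ i * zeta ^- i = 1 by rewrite mulfV // expf_neq0.
have zz i : (0 < i < m)%N -> zeta ^+ i - zeta ^- i != 0.
  move=> Hi; rewrite subr_eq0 -(inj_eq (mulfI (expf_neq0 i zeta_neq0))).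
  rewrite zV -exprD -(prim_order_dvd zetaP); apply/negP => /dvdn_leq; lia.
have r_uniq : uniq r.
  rewrite map_inj_in_uniq ?iota_uniq // => i1 i2; rewrite !mem_iota => Hi1 Hi2 E.
  (* For nonzero x and y, (x + 1/x) - (y + 1/y) equals (x - y)(xy - 1)/(xy). The factor xy - 1 does
     not vanish here since 0 < i1 + i2 < 2m. *)
  have : (zeta ^+ i1 - zeta ^+ i2) * (zeta ^+ (i1 + i2) - 1) = 0.
    transitivity (zeta ^+ i1 * zeta ^+ i2 *
      ((zeta ^+ i1 + zeta ^- i1) - (zeta ^+ i2 + zeta ^- i2)) ).
      have := zV i1; have := zV i2; rewrite exprD.
      move: (zeta ^+ i1) (zeta ^+ i2) => x y; set x' := x^-1; set y' := y^-1 => h1 h2.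
      transitivity (x * y * (x - y) - x * (y * y') + y * (x * x')); last by ring.
      by rewrite h1 h2; ring.
    by rewrite E subrr mulr0.
  move/eqP; rewrite mulf_eq0 !subr_eq0 => /orP[].
    by rewrite (eq_prim_root_expr zetaP) !modn_small => [/eqP//||]; lia.
  by rewrite -(prim_order_dvd zetaP) => /dvdn_leq; lia.
have size_U : size (map_poly (intr : int -> algC) (chebU m)) = m.
  by rewrite size_map_inj_poly ?(size_chebU m).1 //; apply: intr_inj.
have UE : map_poly (intr : int -> algC) (chebU m) = \prod_(a <- r) ('X - a%:P).
  rewrite [LHS](@all_roots_prod_XsubC _ _ r).
  - suff -> : lead_coef (map_poly (intr : int -> algC) (chebU m)) = 1 by rewrite scale1r.
    apply/eqP; rewrite -monicE; apply: monic_map.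
    by case: (m) m_gt0 => // n _; apply: chebU_monic.
  - by rewrite size_U size_map size_iota prednK.
  - apply/allP => _ /mapP[i + ->]; rewrite mem_iota => Him; have {Him} Hi : (0 < i < m)%N by lia.
    have := ev_chebU (zV i) m; rewrite [(zeta ^- i) ^+ m]exprVn -!exprM => E.
    apply/rootP; rewrite -[LHS]/(ev _ _).
    have : (zeta ^+ i - zeta ^- i) * ev (zeta ^+ i + zeta ^- i) (chebU m) = 0.
      apply/eqP; rewrite E subr_eq0 -(inj_eq (mulfI (expf_neq0 (i * m) zeta_neq0))).
      rewrite mulfV ?expf_neq0 // -exprD addnn -mul2n mulnCA [(i * _)%N]mulnC exprM.
      by rewrite (prim_expr_order zetaP) expr1n.
    by move/eqP; rewrite mulf_eq0 (negPf (zz i Hi)) => /eqP.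
  - by rewrite uniq_rootsE.
rewrite rmorphXn /= UE; apply: dvdp_sqr_prod_XsubC => // a /mapP[i + ->].
rewrite mem_iota => Him; have {Him} Hi : (0 < i < m)%N by lia.
(* The square of zeta^i has order k = m / gcd(i, m), which divides m and exceeds 1 because 0 < i <
   m. *)
have kP := exp_prim_root zetaP (i * 2); rewrite exprM in kP.
set k := ((2 * m) %/ _)%N in kP.
have k_gt0 := prim_order_gt0 kP.
have kE : (k * gcdn (i * 2) (2 * m) = 2 * m)%N by rewrite divnK // dvdn_gcdr.
have gE : gcdn (i * 2) (2 * m) = (2 * gcdn i m)%N by rewrite [(i * 2)%N]mulnC muln_gcdr.
have km : (k * gcdn i m = m)%N.
  by apply/eqP; rewrite -(eqn_pmul2l (isT : (0 < 2)%N)) mulnCA -gE kE.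
have k_gt1 : (1 < k)%N.
  rewrite ltn_neqAle k_gt0 andbT; apply/eqP => k1; move: km; rewrite -k1 mul1n => gm.
  by have := dvdn_gcdl i m; rewrite gm => /dvdn_leq; lia.
have kdm : (k %| m)%N by rewrite -km dvdn_mulr.
(* With c = 1 the dual point has second component zeta^i - zeta^-i, nonzero by [zz], so value and
   derivative both vanish. *)
have := lmov_poly_dual 1 kP kdm k_gt1 m_gt0 le_jm tau_gt0.
rewrite ev_dual /dual_pt dualD /= !mul1r mulN1r dual0 => -[P0 /eqP].
rewrite mulf_eq0 (negPf (zz i Hi)) orbF => /eqP P1.
exact: dvdp_sqr_XsubC.
Qed.

(** * Parity in w and passage to polynomials in z^2 *)

Lemma chebU_opp n : chebU n \Po (- 'X) = (-1) ^+ n.+1 * chebU n.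
Proof.
suff: chebU n \Po (- 'X) = (-1) ^+ n.+1 * chebU n /\
      chebU n.+1 \Po (- 'X) = (-1) ^+ n.+2 * chebU n.+1 by case.
elim: n => [|n [IH0 IH1]].
  by rewrite chebU1 chebU0 comp_poly0 comp_polyC mulr0 sqrrN expr1n mulr1.
split=> //; rewrite chebUSS comp_polyB comp_polyM comp_polyX IH0 IH1.
by rewrite !exprS; ring.
Qed.

Lemma dickson_opp n : dickson n \Po (- 'X) = (-1) ^+ n * dickson n.
Proof.
rewrite /dickson comp_polyB !comp_polyM comp_polyX !chebU_opp.
by rewrite rmorph_nat !exprS; ring.
Qed.

Lemma qbin_opp n j : (j <= n)%N ->
  qbin n j \Po (- 'X) = (-1) ^+ (j * (n - j)) * qbin n j.
Proof.
elim: n j => [|n IH] [|j] // le_jn; try by rewrite qbinn0 comp_polyC mulr1.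
rewrite subSS qbinSS comp_polyB !comp_polyM !chebU_opp IH //.
have [lt_jn|le_nj] := ltnP j n; last first.
  have -> : j = n by lia.
  by rewrite subnn [qbin n n.+1]qbin_small // comp_poly0 !muln0 !mulr0 !subr0; ring.
rewrite IH; last by lia.
have [i ->] : exists i, n = (j + i).+1 by exists (n - j).-1; lia.
have -> : ((j + i).+1 - j = i.+1)%N by lia.
have -> : ((j + i).+1 - j.+1 = i)%N by lia.
rewrite [RHS]mulrBr; congr (_ - _).
  by rewrite mulrACA -exprD; congr (_ * _); apply: sign_expr;
     rewrite ?mulrNN ?mulr1 //= !oddD !oddM /=; case: (odd i); case: (odd j).
by rewrite mulrACA -exprD; congr (_ * _); apply: sign_expr;
     rewrite ?mulrNN ?mulr1 //= !oddD !oddM /=; case: (odd i); case: (odd j).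
Qed.

(** For n > 0 the signs of the two factors have total exponent j (n - j) + (n - 1)(n tau - j), which
    is always even. *)
Lemma lmov_coef_even tau n j : (0 < tau)%N -> (j <= n)%N ->
  lmov_coef tau n j \Po (- 'X) = lmov_coef tau n j.
Proof.
move=> tau_gt0 le_jn; rewrite /lmov_coef !comp_polyM; congr (_ * _).
  exact: rmorph_sign.
case: n le_jn => [|n] le_jn.
  have -> : j = 0%N by lia.
  by rewrite !qbinn0 comp_polyC.
have le_n : (n.+1 <= n.+1 * tau)%N by rewrite leq_pmulr.
rewrite !qbin_opp //; last by lia.
rewrite mulrACA -exprD (_ : (-1) ^+ _ = 1) ?mul1r //.
rewrite -[RHS](expr0 (-1)); apply: sign_expr; rewrite ?mulrNN ?mulr1 //=.
have -> : ((n.+1 * tau + n.+1 - j).-1 - n = n.+1 * tau - j)%N by lia.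
rewrite oddD !oddM (oddB le_jn) oddB ?(leq_trans le_jn) // oddM /=.
by case: (odd n); case: (odd j); case: (odd tau).
Qed.

Lemma lmov_poly_even tau m j : (0 < tau)%N -> (0 < m)%N -> (j <= m)%N ->
  lmov_poly tau m j \Po (- 'X) = lmov_poly tau m j.
Proof.
move=> tau_gt0 m_gt0 le_jm; rewrite /lmov_poly rmorph_sum; apply: eq_big_seq => d.
rewrite -dvdn_divisors // => dm /=; rewrite rmorphM rmorph_int /=; congr (_ * _).
case: ifP => dj; last by rewrite comp_poly0.
rewrite -comp_polyA dickson_opp -signr_odd; case: (odd d); last by rewrite mul1r.
rewrite expr1 mulN1r -[in RHS](@lmov_coef_even _ _ _ tau_gt0 (leq_div2r d le_jm)).
by rewrite -comp_polyA rmorphN /= comp_polyX.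
Qed.

Lemma even_polyP (R : {poly int}) : R \Po (- 'X) = R -> R = even_poly R \Po 'X^2.
Proof.
rewrite -{1 2}[R]poly_even_odd comp_polyD comp_polyM comp_polyX -!comp_polyA.
rewrite comp_Xn_poly sqrrN => /addrI/eqP; rewrite mulrN eq_sym -addr_eq0 -mulr2n.
rewrite -mulr_natl mulf_eq0 -polyC_natr polyC_eq0 /= => /eqP odd0.
by rewrite -{1}[R]poly_even_odd odd0 addr0.
Qed.

Lemma lmov_poly_z2 tau m j : (0 < tau)%N -> (0 < m)%N -> (j <= m)%N ->
  exists S : {poly int}, forall (F : comNzRingType) (s si : F), s * si = 1 ->
    ev (s + si) (lmov_poly tau m j) =
    ev ((s - si) ^+ 2) S * ev (s + si) (chebU m) ^+ 2.
Proof.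
move=> tau_gt0 m_gt0 le_jm.
have [R RE] := chebU_sqr_dvd_lmov_poly m_gt0 le_jm tau_gt0.
have U_neq0 : chebU m ^+ 2 != 0.
  by rewrite expf_neq0 //; case: (m) m_gt0 => // n _; apply: chebU_neq0.
have R_even : R \Po (- 'X) = R.
  apply: (mulIf U_neq0); rewrite -RE -(lmov_poly_even tau_gt0 m_gt0 le_jm) RE.
  rewrite comp_polyM; congr (_ * _); rewrite expr2 comp_polyM chebU_opp mulrACA.
  by rewrite -exprMn mulrNN mulr1 expr1n mul1r.
(* The shift by 4 is w^2 = z^2 + 4. *)
exists (even_poly R \Po ('X + 4%:R)) => F s si ssi.
rewrite ev_comp evD evX ev_nat.
have -> : (s - si) ^+ 2 + 4%:R = (s + si) ^+ 2.
  by transitivity ((s - si) ^+ 2 + 4%:R * (s * si)); [rewrite ssi mulr1 | ring].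
rewrite RE expr2 !evM -expr2 {1}(even_polyP R_even) ev_comp; congr (ev _ _ * _).
by rewrite expr2 evM evX.
Qed.

(** * Sums over partitions and Newton's identities *)

Lemma mem_words k n w :
  (w \in words k n) = (size w == k) && all (fun x => 0 < x <= n)%N w.
Proof.
elim: k w => [|k IH] w; first by case: w.
apply/allpairsP/idP => [[[x v] /= [xn vk ->]]|].
  by move: xn vk; rewrite mem_iota add1n ltnS IH /= eqSS => -> ->.
case: w => [|x w] //=; rewrite eqSS => /and3P[sw xn wn].
by exists (x, w); rewrite /= mem_iota add1n ltnS xn IH sw wn.
Qed.

Lemma leq_sumn_mem x s : x \in s -> (x <= sumn s)%N.
Proof. by move=> xs; rewrite (perm_sumn (perm_to_rem xs)) leq_addr. Qed.

Lemma mem_partitions n nu : (nu \in partitions n) = is_partition n nu.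
Proof.
rewrite mem_undup mem_filter andb_idr // => /and3P[pos _ /eqP sum_nu].
apply/flatten_mapP; exists (size nu).
  rewrite mem_iota add0n ltnS -sum_nu; elim: nu pos {sum_nu} => //= x s IH /andP[x_gt0 /IH].
  by lia.
rewrite mem_words eqxx /=; apply/allP => x xnu.
by rewrite (allP pos) // -sum_nu leq_sumn_mem.
Qed.

Lemma zfrak_bound nu M : (sumn nu <= M)%N ->
  zfrak nu = (\prod_(1 <= j < M.+1) (j ^ count_mem j nu * (count_mem j nu)`!))%N.
Proof.
move=> le_M; rewrite [RHS](big_cat_nat (n := (sumn nu).+1)) //=.
rewrite [X in (_ * X)%N]big_nat_cond [X in (_ * X)%N]big1 ?muln1 // => j.
rewrite andbT => /andP[lt_j _]; suff -> : count_mem j nu = 0%N by [].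
by apply/count_memPn; apply: contraL lt_j => /leq_sumn_mem; rewrite -leqNgt.
Qed.

Lemma zfrak_rem k nu : (0 < k)%N -> k \in nu ->
  zfrak nu = (k * count_mem k nu * zfrak (rem k nu))%N.
Proof.
move=> k_gt0 knu.
have sumE : sumn nu = (k + sumn (rem k nu))%N := perm_sumn (perm_to_rem knu).
have kS : k \in index_iota 1 (sumn nu).+1.
  by rewrite mem_index_iota k_gt0 ltnS leq_sumn_mem.
rewrite (@zfrak_bound (rem k nu) (sumn nu)); last by rewrite sumE leq_addl.
rewrite /zfrak !(bigD1_seq k kS) ?iota_uniq //= mulnA; congr (_ * _)%N; last first.
  by apply: eq_bigr => j jk; rewrite count_rem knu /= [k == j]eq_sym (negPf jk) subn0.
rewrite count_rem knu /= eqxx.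
have : (0 < count_mem k nu)%N by rewrite -has_count has_pred1.
case: (count_mem k nu) => // c _; rewrite subn1 /= expnS factS; nia.
Qed.

Lemma sumn_count (r nu : seq nat) : uniq r -> {subset nu <= r} ->
  sumn nu = (\sum_(k <- r) k * count_mem k nu)%N.
Proof.
move=> r_uniq; elim: nu => [|x nu IH] sub.
  by rewrite big1 // => k _; rewrite muln0.
have xr : x \in r by apply: sub; apply: mem_head.
rewrite /= IH => [|y ynu]; last by apply: sub; rewrite inE ynu orbT.
rewrite (bigD1_seq x) //= [RHS](bigD1_seq x) //= eqxx mulnDr muln1 addnA.
by congr (_ + _)%N; apply: eq_bigr => k /negPf kx; rewrite eq_sym kx.
Qed.

Lemma geq_trans : transitive geq.
Proof. by move=> y x z; rewrite /geq /= => h1 h2; apply: leq_trans h2 h1. Qed.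

Lemma geq_anti : antisymmetric geq.
Proof. by move=> x y; rewrite /geq /= andbC => /anti_leq. Qed.

Lemma geq_total : total geq.
Proof. by move=> x y; rewrite /geq /= orbC leq_total. Qed.

(** Inserting k and sorting again inverts the removal of one part k. *)
Lemma perm_partitions_rem n k : (0 < k <= n)%N ->
  perm_eq [seq rem k nu | nu <- [seq nu <- partitions n | k \in nu]]
          (partitions (n - k)).
Proof.
move=> /andP[k_gt0 le_kn]; apply: uniq_perm; rewrite ?undup_uniq //.
  rewrite map_inj_in_uniq ?filter_uniq ?undup_uniq // => x y.
  rewrite !mem_filter !mem_partitions => /andP[kx /and3P[_ sx _]] /andP[ky /and3P[_ sy _]] E.
  apply: (sorted_eq geq_trans geq_anti) => //.
  by rewrite (permPl (perm_to_rem kx)) E perm_sym perm_to_rem.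
move=> nu; rewrite mem_partitions; apply/mapP/idP => [[x]|].
  rewrite mem_filter mem_partitions => /andP[kx /and3P[px sx /eqP nx]] ->.
  apply/and3P; split.
  - by apply/allP => y /mem_rem; apply: (allP px).
  - exact: (subseq_sorted geq_trans (rem_subseq k x)).
  - by rewrite -nx (perm_sumn (perm_to_rem kx)) addKn.
move=> /and3P[pnu snu /eqP nnu]; exists (sort geq (k :: nu)); last first.
  apply: (sorted_eq geq_trans geq_anti) => //.
    apply: (subseq_sorted geq_trans (rem_subseq k _)); exact: (sort_sorted geq_total).
  rewrite -(perm_cons k) perm_sym -(permPl (perm_to_rem _)) ?mem_sort ?mem_head //.
  by rewrite perm_sort.
have P : perm_eq (sort geq (k :: nu)) (k :: nu) by rewrite perm_sort.
rewrite mem_filter mem_sort mem_head mem_partitions /=.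
apply/and3P; split; first by rewrite (perm_all _ P) /= k_gt0.
  exact: (sort_sorted geq_total).
by rewrite (perm_sumn P) /= nnu subnKC.
Qed.

Section Newton.
Variable F : fieldType.
Hypothesis nat_neq0 : forall n, n.+1%:R != 0 :> F.

Definition newton (p h : nat -> F) : Prop :=
  h 0%N = 1 /\
  forall n, n.+1%:R * h n.+1 = \sum_(j < n.+1) p j.+1 * h (n - j)%N.

Definition complete_sum (p : nat -> F) (n : nat) : F :=
  \sum_(nu <- partitions n) (zfrak nu)%:R^-1 * \prod_(x <- nu) p x.

(** Each partition of n + 1 is weighted by n + 1, the sum of k m_k over its part sizes k. Removing
    one part k turns k m_k / z_nu into the reciprocal of z for the smaller partition. *)
Lemma newton_complete_sum p : newton p (complete_sum p).
Proof.
split=> [|n].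
  have -> : complete_sum p 0 = \sum_(nu <- [:: [::]]) (zfrak nu)%:R^-1 * \prod_(x <- nu) p x.
    by [].
  by rewrite big_seq1 big_nil /zfrak big_nil mulr1 invr1.
have -> : \sum_(j < n.+1) p j.+1 * complete_sum p (n - j) =
          \sum_(1 <= k < n.+2) p k * complete_sum p (n.+1 - k).
  by rewrite big_add1 big_mkord.
rewrite /complete_sum big_distrr /=.
transitivity (\sum_(nu <- partitions n.+1) \sum_(1 <= k < n.+2)
   (k * count_mem k nu)%:R * ((zfrak nu)%:R^-1 * \prod_(x <- nu) p x)).
  apply: eq_big_seq => nu; rewrite mem_partitions => /and3P[pos _ /eqP nuE].
  rewrite -big_distrl /= -natr_sum -sumn_count ?iota_uniq ?nuE // => x xnu.
  by rewrite mem_index_iota (allP pos) // ltnS -nuE leq_sumn_mem.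
rewrite exchange_big /=; apply: eq_big_nat => k k_n.
rewrite (bigID (fun nu => k \in nu)) /= addrC big1 ?add0r => [|nu /count_memPn ->]; last first.
  by rewrite muln0 mul0r.
rewrite -(perm_big _ (perm_partitions_rem k_n)) /= big_map big_filter big_distrr /=.
apply: eq_bigr => nu knu; have [k_gt0 _] := andP k_n.
rewrite (zfrak_rem k_gt0 knu) [(_ * zfrak _)%:R]natrM invfM (perm_big _ (perm_to_rem knu)) big_cons /=.
have h : (k * count_mem k nu)%:R != 0 :> F.
  have : (0 < k * count_mem k nu)%N by rewrite muln_gt0 k_gt0 -has_count has_pred1.
  by case: (k * _)%N => // c _; apply: nat_neq0.
by rewrite mulrA mulrA mulfV // mul1r mulrCA.
Qed.

Lemma newton_uniq p p' h h' : (forall k, p k.+1 = p' k.+1) ->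
  newton p h -> newton p' h' -> h =1 h'.
Proof.
move=> pp [h0 hS] [h0' hS']; elim/ltn_ind=> -[|n] IH; first by rewrite h0 h0'.
apply: (mulfI (nat_neq0 n)); rewrite hS hS'; apply: eq_bigr => j _.
by rewrite pp IH // ltnS leq_subr.
Qed.

(* Newton's identities say that the generating series satisfies [H' = P H]. *)
Lemma newton_conv p p' h h' : newton p h -> newton p' h' ->
  newton (fun k => p k + p' k) (fun n => \sum_(i < n.+1) h i * h' (n - i)%N).
Proof.
move=> [h0 hS] [h0' hS']; split=> [|n].
  by rewrite big_ord_recl big_ord0 h0 h0' mulr1 addr0.
(* [A] truncates a generating series, leaving coefficients up to n + 1 intact; [B] shifts by one,
   since the series P has coefficients p_(k+1). *)
pose A f := \poly_(i < n.+2) (f i : F); pose B f := \poly_(i < n.+2) (f i.+1 : F).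
have coefA f g m : (m <= n.+1)%N -> (A f * A g)`_m = \sum_(i < m.+1) f i * g (m - i)%N.
  move=> le_m; rewrite coefM; apply: eq_bigr => i _; rewrite !coef_poly.
  by rewrite !(leq_ltn_trans _ (le_m : (m < n.+2)%N)) ?leq_subr // -ltnS.
have derA q f m : (forall k, k.+1%:R * f k.+1 = \sum_(j < k.+1) q j.+1 * f (k - j)%N) ->
    (m <= n)%N -> (A f)^`()`_m = (B q * A f)`_m.
  move=> fS le_m; rewrite coef_deriv coef_poly !ltnS le_m -mulr_natl fS coefM.
  apply: eq_bigr => i _; rewrite !coef_poly.
  by rewrite !(leq_ltn_trans _ (leqW le_m : (m < n.+2)%N)) ?leq_subr // -ltnS.
rewrite -coefA // mulr_natl -coef_deriv derivM coefD.
have -> : ((A h)^`() * A h')`_n = (B p * A h * A h')`_n.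
  by rewrite !coefM; apply: eq_bigr => i _; rewrite (derA p) // -ltnS.
have -> : (A h * (A h')^`())`_n = (A h * (B p' * A h'))`_n.
  by rewrite !coefM; apply: eq_bigr => i _; rewrite (derA p') // leq_subr.
rewrite -coefD (_ : _ + _ = (B p + B p') * (A h * A h')); last by ring.
rewrite coefM; apply: eq_bigr => i _; rewrite coefA ?(leqW (leq_subr _ _)) //.
by rewrite coefD !coef_poly (leq_trans (ltn_ord i)).
Qed.

Lemma newton_scale c p h : newton p h ->
  newton (fun k => c ^+ k * p k) (fun n => c ^+ n * h n).
Proof.
move=> [h0 hS]; split=> [|n]; first by rewrite h0 mulr1.
rewrite mulrCA hS big_distrr /=; apply: eq_bigr => j _.
by rewrite mulrACA -exprD addSn subnKC // -ltnS.
Qed.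

(** The case of a single variable c. *)
Lemma newton_geom c : newton (fun k => c ^+ k) (fun n => c ^+ n).
Proof.
split=> // n; rewrite (eq_bigr (fun _ => c ^+ n.+1)) => [|j _].
  by rewrite sumr_const card_ord mulr_natl.
by rewrite -exprD addSn subnKC // -ltnS.
Qed.

End Newton.

(** * The q-binomial theorem *)

(** Both sides are the same quotient of factorials. For N = n tau this turns the denominator {n}{N}
    in Z_n into {n}^2. *)
Lemma qbin_swap N n j : (0 < n)%N -> (j <= n)%N -> (n <= N)%N ->
  chebU n * (qbin N j * qbin (N + (n - j)).-1 (n - j)) =
  chebU N * (qbin n j * qbin (N + n - j).-1 n.-1).
Proof.
move=> n_gt0 le_jn le_nN.
rewrite -addnBA //.
case: n N n_gt0 le_nN le_jn => [|n] [|N] // _ le_nN le_jn; rewrite addSn /=.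
have h1 := qbin_fact (leq_trans le_jn le_nN).
have h2 := @qbin_fact (N + (n.+1 - j)) (n.+1 - j) (leq_addl _ _).
have h3 := qbin_fact le_jn.
have h4 := @qbin_fact (N + (n.+1 - j)) n ltac:(lia).
have i1 : (N + (n.+1 - j) - (n.+1 - j) = N)%N by lia.
have i2 : (N + (n.+1 - j) - n = N.+1 - j)%N by lia.
rewrite i1 in h2; rewrite i2 in h4.
have nz := qfact_neq0.
apply: (mulIf (mulf_neq0 (mulf_neq0 (mulf_neq0 (nz j) (nz (N.+1 - j)%N)) (nz (n.+1 - j)%N))
  (mulf_neq0 (nz N) (nz n)))).
transitivity (qfact n.+1 * qfact N.+1 * qfact (N + (n.+1 - j))).
  by rewrite qfactS -h1 -h2; ring.
by rewrite (qfactS N) -h3 -h4; ring.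
Qed.

Section FramedUnknot.
Variables (F : fieldType) (s : F).
Hypothesis nat_neq0 : forall n, n.+1%:R != 0 :> F.
Hypothesis s_neq0 : s != 0.
Hypothesis s_generic : forall n, s ^+ n.+1 - s^-1 ^+ n.+1 != 0.

Let br n : F := s ^+ n - s^-1 ^+ n.
Let w := s + s^-1.

Lemma ssV : s * s^-1 = 1. Proof. exact: mulfV. Qed.

(** For u = s^N these are the power sums of the N variables s^(N-1), s^(N-3), ..., s^(1-N). *)
Definition qpower (u : F) (k : nat) : F := (u ^+ k - u^-1 ^+ k) / br k.

(* The power sums [s^k p_k + u^-k] and [s^-k p_k + u^k] coincide for
   [p = qpower u]; comparing the complete sums yields the recurrence. *)
Lemma newton_qpower u h : u != 0 -> newton (qpower u) h ->
  forall n, h n.+1 * br n.+1 = h n * (u * s ^+ n - u^-1 * s^-1 ^+ n).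
Proof.
move=> u_neq0 hN; have uuV : u * u^-1 = 1 by rewrite mulfV.
pose L n := \sum_(i < n.+1) s ^+ i * h i * u^-1 ^+ (n - i).
pose R n := \sum_(i < n.+1) s^-1 ^+ i * h i * u ^+ (n - i).
have LR : L =1 R.
  apply: (newton_uniq nat_neq0 _ (newton_conv (newton_scale s hN) (newton_geom u^-1))
                               (newton_conv (newton_scale s^-1 hN) (newton_geom u))).
  move=> k; apply/eqP; rewrite -subr_eq0; apply/eqP.
  transitivity (br k.+1 * qpower u k.+1 - (u ^+ k.+1 - u^-1 ^+ k.+1)); first by rewrite /br; ring.
  by rewrite /qpower mulrC divfK ?subrr // s_generic.
have step c d n : \sum_(i < n.+2) c ^+ i * h i * d ^+ (n.+1 - i) =
    d * (\sum_(i < n.+1) c ^+ i * h i * d ^+ (n - i)) + c ^+ n.+1 * h n.+1.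
  rewrite big_ord_recr /= subnn mulr1 big_distrr /=; congr (_ + _).
  apply: eq_bigr => i _; by rewrite subSn ?leq_ord // exprS; ring.
have hL n : h n.+1 * br n.+1 = (u - u^-1) * L n.
  have := LR n.+1; rewrite /L /R !step -/(L n) -/(R n) -LR => E.
  transitivity (u^-1 * L n + s ^+ n.+1 * h n.+1 - (u^-1 * L n + s^-1 ^+ n.+1 * h n.+1)).
    by rewrite /br; ring.
  by rewrite E; ring.
case=> [|n].
  by rewrite hL /L big_ord_recl big_ord0 !expr0 !mulr1 hN.1; ring.
rewrite hL /L step -/(L n).
transitivity (u^-1 * ((u - u^-1) * L n) + (u - u^-1) * s ^+ n.+1 * h n.+1); first by ring.
by rewrite -hL /br; ring.
Qed.

(** The absorption rule {n+1} [N+n, n+1] = {N+n} [N+n-1, n] is the recurrence of [newton_qpower] at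
    u = s^N. *)
Lemma complete_qpower N n : (0 < N)%N ->
  complete_sum (qpower (s ^+ N)) n = ev w (qbin (N + n).-1 n).
Proof.
move=> N_gt0; elim: n => [|n IH].
  by rewrite (newton_complete_sum nat_neq0 _).1 qbinn0 ev1.
apply: (mulIf (s_generic n)).
rewrite (newton_qpower (expf_neq0 N s_neq0) (newton_complete_sum nat_neq0 _)) IH.
have Nn : (N + n = (N + n).-1.+1)%N by rewrite prednK // addn_gt0 N_gt0.
have := qbinSS_mul (N + n).-1 n; rewrite -Nn => /(congr1 (ev w)); rewrite !evM => E.
rewrite addnS /= -(ev_chebU ssV n.+1) -/w.
transitivity ((s - s^-1) * (ev w (chebU n.+1) * ev w (qbin (N + n) n.+1))); last by ring.
by rewrite E mulrA (ev_chebU ssV) !exprD -[(s ^+ N)^-1]exprVn; ring.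
Qed.

(** Replacing s^N by its inverse negates the power sums, so the complete functions become signed
    elementary ones. *)
Lemma complete_qpowerV N n :
  complete_sum (qpower (s ^- N)) n = (-1) ^+ n * ev w (qbin N n).
Proof.
have sN : s ^- N != 0 by rewrite invr_neq0 // expf_neq0.
elim: n => [|n IH].
  by rewrite (newton_complete_sum nat_neq0 _).1 qbinn0 ev1 mulr1.
apply: (mulIf (s_generic n)).
rewrite (newton_qpower sN (newton_complete_sum nat_neq0 _)) IH.
have := qbin_mulS N n => /(congr1 (ev w)); rewrite !evM => E.
rewrite -(ev_chebU ssV) -/w.
transitivity (- (-1) ^+ n * ((s - s^-1) * (ev w (chebU n.+1) * ev w (qbin N n.+1)))); last first.
  by rewrite exprS; ring.
rewrite E [(s - s^-1) * _]mulrA (ev_chebU ssV).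
have [le_nN|lt_Nn] := leqP n N; last by rewrite qbin_small // ev0 !mulr0 mul0r.
have -> : s ^+ (N - n) = s ^+ N * s^-1 ^+ n.
  by rewrite -{2}(subnK le_nN) exprD -mulrA -exprMn ssV expr1n mulr1.
have -> : s^-1 ^+ (N - n) = s^-1 ^+ N * s ^+ n.
  by rewrite -{2}(subnK le_nN) exprD -mulrA -exprMn [_^-1 * _]mulrC ssV expr1n mulr1.
by rewrite invrK -exprVn; ring.
Qed.

(** The power sums split as t^k [qpower] (s^N) + t^-k [qpower] (s^-N), so the complete sums are
    convolved. *)
Lemma complete_sum_framed N n t : (0 < N)%N -> t != 0 ->
  complete_sum (fun k => (s ^+ N ^+ k - s ^- N ^+ k) * (t ^+ k - t^-1 ^+ k) / br k) n =
  \sum_(j < n.+1) (-1) ^+ j * t ^+ (n - j) * t^-1 ^+ j *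
     ev w (qbin N j * qbin (N + (n - j)).-1 (n - j)).
Proof.
move=> N_gt0 t_neq0.
have := newton_conv
  (newton_scale t^-1 (newton_complete_sum nat_neq0 (qpower (s ^- N))))
  (newton_scale t (newton_complete_sum nat_neq0 (qpower (s ^+ N)))).
move=> H; rewrite (newton_uniq nat_neq0 _ (newton_complete_sum nat_neq0 _) H).
  apply: eq_bigr => j _.
  by rewrite complete_qpowerV complete_qpower // evM; ring.
by move=> k; rewrite /qpower invrK; ring.
Qed.

Lemma qquot_mul tau n nu : nu != [::] ->
  qquot (Posz tau) n nu s * br (n * tau) =
  \prod_(x <- nu) (s ^+ (n * tau) ^+ x - s ^- (n * tau) ^+ x).
Proof.
case: nu => // x nu _; rewrite big_cons /= mulrAC.
have qbrE (y : nat) : qbr s (n%:Z * y%:Z * tau%:Z) = s ^+ (n * tau) ^+ y - s ^- (n * tau) ^+ y.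
  by rewrite /qbr -!PoszM mulnAC -exprnN -exprnP exprM exprVn.
congr (_ * _); last by apply: eq_bigr => y _; apply: qbrE.
set v := s ^+ (n * tau).
have v_neq0 : v != 0 by rewrite expf_neq0.
have -> : br (n * tau) = v - v^-1 by rewrite /br exprVn.
(* Multiplying v^(x-1-2k) by v - v^-1 gives v^(x-2k) - v^(x-2k-2), so the sum telescopes. *)
pose f k := - v ^ (x%:Z - 2 * k%:Z).
transitivity (\sum_(0 <= k < x) (f k.+1 - f k)).
  rewrite big_mkord big_distrl /=; apply: eq_bigr => k _; rewrite /f opprK [RHS]addrC.
  have vE z : s ^ (n%:Z * tau%:Z * z) = v ^ z by rewrite /v exprnP exprz_exp PoszM.
  rewrite vE.
  rewrite mulrBr -{2}[v]expr1z -exprN1 -!expfzDr //.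
  by congr (v ^ _ - v ^ _); lia.
rewrite telescope_sumr // /f opprK mulr0 subr0 addrC -exprnP; congr (_ - _).
by rewrite exprVn exprnN; congr (v ^ _); lia.
Qed.
End FramedUnknot.

(** * Expansion of [Zn] and [gm] *)

Lemma sum_dvd_ord (V : nmodType) m d (G : nat -> V) : (0 < d)%N -> (d %| m)%N ->
  \sum_(j < m.+1) (if (d %| j)%N then G (j %/ d)%N else 0) =
  \sum_(j < (m %/ d).+1) G j.
Proof.
move=> d_gt0 dm; rewrite -(big_mkord xpredT (fun j => if (d %| j)%N then G (j %/ d)%N else 0)).
rewrite -(big_mkord xpredT G) -big_mkcond -[LHS]big_filter.
rewrite (perm_big [seq (d * j)%N | j <- index_iota 0 (m %/ d).+1]).
  by rewrite big_map; apply: eq_bigr => j _; rewrite mulKn.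
apply: uniq_perm; rewrite ?filter_uniq ?iota_uniq //.
  rewrite map_inj_uniq ?iota_uniq // => x y /eqP.
  by rewrite eqn_pmul2l // => /eqP.
move=> j; rewrite mem_filter mem_index_iota leq0n andTb; apply/andP/mapP.
  case=> dj; rewrite ltnS => le_jm; exists (j %/ d)%N; last by rewrite mulnC divnK.
  by rewrite mem_index_iota ltnS leq_div2r.
case=> x; rewrite mem_index_iota /= ltnS leq_divRL // => le_xm ->.
by rewrite dvdn_mulr // ltnS mulnC.
Qed.

Lemma partitions_neq_nil n nu : (0 < n)%N -> nu \in partitions n -> nu != [::].
Proof.
by move=> n_gt0; rewrite mem_partitions => /and3P[_ _ /eqP E]; case: nu E n_gt0 => //= <-.
Qed.

Lemma prodrN_seq (R : comPzRingType) (I : Type) (r : seq I) (G : I -> R) :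
  \prod_(x <- r) - G x = (-1) ^+ size r * \prod_(x <- r) G x.
Proof.
elim: r => [|x r IH]; first by rewrite !big_nil mulr1.
by rewrite !big_cons IH exprS; ring.
Qed.

Section Expansion.
Variable F : fieldType.
Hypothesis nat_neq0 : forall n, n.+1%:R != 0 :> F.

Lemma qbr_nat (x : F) n : qbr x n%:Z = x ^+ n - x^-1 ^+ n.
Proof. by rewrite /qbr -exprnN exprVn. Qed.

Section Generic.
Variable s : F.
Hypothesis s_neq0 : s != 0.
Hypothesis s_generic : forall n, s ^+ n.+1 - s^-1 ^+ n.+1 != 0.

Lemma qbr_neq0 n : (0 < n)%N -> qbr s n%:Z != 0.
Proof. by case: n => // n _; rewrite qbr_nat s_generic. Qed.

(** Multiplying the quotient by {n tau} makes each summand a product over the parts, so a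
    [complete_sum] appears; [qbin_swap] brings its value into the form of [lmov_coef]. *)
Lemma Zn_expansion tau n t : (0 < tau)%N -> (0 < n)%N -> t != 0 ->
  Zn (Posz tau) n s t = \sum_(j < n.+1) ev (s + s^-1) (lmov_coef tau n j)
    / qbr s n%:Z ^+ 2 * (t ^+ (n - j) * t^-1 ^+ j).
Proof.
move=> tau_gt0 n_gt0 t_neq0.
set N := (n * tau)%N; have N_gt0 : (0 < N)%N by rewrite muln_gt0 n_gt0.
have n_neq0 := qbr_neq0 n_gt0; have N_neq0 := qbr_neq0 N_gt0.
pose p k := (s ^+ N ^+ k - s ^- N ^+ k) * (t ^+ k - t^-1 ^+ k) / (s ^+ k - s^-1 ^+ k).
have -> : Zn (Posz tau) n s t =
    (-1) ^+ N / (qbr s n%:Z * qbr s N%:Z) * complete_sum p n.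
  rewrite /Zn -PoszM -exprnP -/N -mulrA; congr (_ * _).
  rewrite /complete_sum big_distrr /=; apply: eq_big_seq => nu nuP.
  have := qquot_mul s_neq0 tau n (partitions_neq_nil n_gt0 nuP).
  rewrite -qbr_nat -/N => /(canRL (mulfK N_neq0)) ->.
  rewrite /p !big_split /= prodfV.
  rewrite !(eq_bigr _ (fun x _ => qbr_nat _ x)).
  by rewrite invfM; ring.
rewrite (complete_sum_framed nat_neq0 s_neq0 s_generic n N_gt0 t_neq0) big_distrr /=.
apply: eq_bigr => j _; rewrite /lmov_coef !evM.
have sgE k : ev (s + s^-1) ((-1) ^+ k) = (-1) ^+ k by exact: rmorph_sign.
rewrite sgE exprD -/N.
have le_jn : (j <= n)%N by rewrite -ltnS.
have le_nN : (n <= N)%N by rewrite leq_pmulr.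
have := congr1 (fun P => (s - s^-1) * ev (s + s^-1) P) (qbin_swap n_gt0 le_jn le_nN).
rewrite /= !evM ![(s - s^-1) * _]mulrA !(ev_chebU (mulfV s_neq0)) -!qbr_nat => E.
transitivity ((-1) ^+ N * (-1) ^+ j * (t ^+ (n - j) * t^-1 ^+ j) /
   (qbr s n%:Z ^+ 2 * qbr s N%:Z) * (qbr s n%:Z *
     (ev (s + s^-1) (qbin N j) * ev (s + s^-1) (qbin (N + (n - j)).-1 (n - j))))).
  by field; rewrite n_neq0 N_neq0.
by rewrite E [(s - s^-1) * _]mulrA (ev_chebU (mulfV s_neq0)) -qbr_nat; field; rewrite n_neq0 N_neq0.
Qed.

Lemma qquot0 n x y nu : qquot 0 n (x :: y :: nu) s = 0.
Proof.
have qbr0 : qbr s (n%:Z * y%:Z * 0) = 0 by rewrite mulr0 /qbr oppr0 subrr.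
by rewrite /= big_cons qbr0 mul0r mulr0.
Qed.

Arguments qquot : simpl never.

(** Every part after the first contributes a factor {0} = 0, so only the one-part partition
    survives; its quotient n cancels against [zfrak]. *)
Lemma Zn_tau0 n t : (0 < n)%N -> Zn 0 n s t = qbr t n%:Z / qbr s n%:Z ^+ 2.
Proof.
move=> n_gt0; rewrite /Zn mulr0 expr0z mul1r.
have nP : [:: n] \in partitions n.
  by rewrite mem_partitions /is_partition /= n_gt0 addn0 eqxx.
rewrite (bigD1_seq _ nP) ?undup_uniq //= [X in _ + X]big1_seq ?addr0 => [|nu /andP[nu_n nuP]].
  have -> : qquot 0 n [:: n] s = n%:R.
    rewrite /qquot big_nil mulr1 (eq_bigr (fun _ => 1)) => [|k _]; last by rewrite mulr0 mul0r.
    by rewrite sumr_const card_ord.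
  have -> : zfrak [:: n] = n.
    by rewrite (@zfrak_rem n) ?mem_head //= eqxx /zfrak /= big_geq // !muln1.
  rewrite !big_seq1; have := qbr_neq0 n_gt0 => s_n.
  have : n%:R != 0 :> F by case: (n) n_gt0 => // k _; apply: nat_neq0.
  move=> n_neq0; rewrite [n%:R^-1 * _]mulrA mulVf // mul1r expr2 invfM.
  by rewrite mulrCA.
case: nu nu_n nuP => [|x [|y nu]] nu_n nuP.
- by have := partitions_neq_nil n_gt0 nuP.
- move: nuP nu_n; rewrite mem_partitions => /and3P[_ _ /eqP] /=.
  by rewrite addn0 => ->; rewrite eqxx.
by rewrite qquot0 mul0r mulr0 mul0r.
Qed.

End Generic.

Lemma qbrN (x : F) k : qbr x (- k) = - qbr x k.
Proof. by rewrite /qbr opprK opprB. Qed.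

Lemma qbrV (x : F) k : qbr x^-1 k = - qbr x k.
Proof. by rewrite /qbr !exprz_inv opprK opprB. Qed.

Lemma qquot_opp tau n nu (s : F) :
  qquot (- tau) n nu s = (-1) ^+ (size nu).-1 * qquot tau n nu s.
Proof.
case: nu => [|x nu]; first by rewrite mulr1.
rewrite /= mulrCA; congr (_ * _).
  rewrite (reindex_inj rev_ord_inj) /=; apply: eq_bigr => k _.
  have -> : (rev_ord k)%:Z = x%:Z - 1 - k%:Z by have := ltn_ord k; rewrite /=; lia.
  by congr (s ^ _); ring.
rewrite -prodrN_seq; apply: eq_bigr => y _; by rewrite mulrN qbrN.
Qed.

(** A partition with l parts yields l - 1 signs from the quotient and l signs from inverting t, in
    total one sign. *)
Lemma Zn_opp tau n (s t : F) : (0 < n)%N -> Zn (- tau) n s t = - Zn tau n s t^-1.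
Proof.
move=> n_gt0; rewrite /Zn -mulrN -sumrN mulrN -exprz_inv invrN1; congr (_ * _).
apply: eq_big_seq => nu /(partitions_neq_nil n_gt0) nu0.
have -> : \prod_(x <- nu) qbr t^-1 x%:Z = (-1) ^+ size nu * \prod_(x <- nu) qbr t x%:Z.
  by rewrite -prodrN_seq; apply: eq_bigr => x _; apply: qbrV.
rewrite qquot_opp; case: nu nu0 => // x nu _.
rewrite [size _]/= [(size nu).+1.-1]/=; by rewrite exprS; ring.
Qed.

Lemma gm_opp tau m (s t : F) : (0 < m)%N -> gm (- tau) m s t = - gm tau m s t^-1.
Proof.
move=> m_gt0; rewrite /gm -sumrN; apply: eq_big_seq => d; rewrite -dvdn_divisors // => dm.
have d_gt0 := dvdn_gt0 m_gt0 dm.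
by rewrite Zn_opp ?mulrN ?exprVn // divn_gt0 // dvdn_leq.
Qed.

End Expansion.

(** * Integrality of g_m at a point s that is not a root of unity *)

Section GmExpansion.
Variables (F : fieldType) (s : F).
Hypothesis nat_neq0 : forall n, n.+1%:R != 0 :> F.
Hypothesis s_neq0 : s != 0.
Hypothesis s_generic : forall n, s ^+ n.+1 - s^-1 ^+ n.+1 != 0.

(** Replacing q by q^d turns {m/d} into {m}, so all summands share the denominator {m}^2; the j-th
    term for d contributes to a^(m/2 - d j). *)
Lemma gm_expansion tau m t : (0 < tau)%N -> (0 < m)%N -> t != 0 ->
  gm (Posz tau) m s t = \sum_(j < m.+1) ev (s + s^-1) (lmov_poly tau m j)
    / qbr s m%:Z ^+ 2 * (t ^+ (m - j) * t^-1 ^+ j).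
Proof.
move=> tau_gt0 m_gt0 t_neq0.
pose G d j := ev (s + s^-1) (lmov_coef tau (m %/ d) j \Po dickson d)
    / qbr s m%:Z ^+ 2 * (t ^+ (m - d * j) * t^-1 ^+ (d * j)).
transitivity (\sum_(j < m.+1) \sum_(d <- divisors m)
   (mobius d)%:~R * (if (d %| j)%N then G d (j %/ d)%N else 0)); last first.
  apply: eq_bigr => j _; rewrite /lmov_poly rmorph_sum /= !big_distrl /=.
  apply: eq_bigr => d _; rewrite evM rmorph_int -!mulrA; congr (_ * _).
  case: ifP => dj; last by rewrite ev0 mul0r.
  by rewrite /G mulnC divnK // !mulrA.
rewrite exchange_big /gm; apply: eq_big_seq => d; rewrite -dvdn_divisors // => dm.
have d_gt0 := dvdn_gt0 m_gt0 dm.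
rewrite -big_distrr /= sum_dvd_ord //; congr (_ * _).
have sd_generic n : (s ^+ d) ^+ n.+1 - (s ^+ d)^-1 ^+ n.+1 != 0.
  rewrite -exprVn -!exprM; case: d d_gt0 {dm} => // d _.
  by rewrite mulSn addSn s_generic.
rewrite (Zn_expansion nat_neq0 (expf_neq0 d s_neq0) sd_generic) ?expf_neq0 //; last first.
  by rewrite divn_gt0 // dvdn_leq.
apply: eq_bigr => j _; rewrite /G ev_comp (ev_dickson (mulfV s_neq0)) exprVn.
rewrite !qbr_nat -[(s ^+ d)^-1]exprVn -!exprM [(d * (m %/ d))%N]mulnC.
congr (_ / _ * (_ * _)).
- by rewrite divnK.
- by congr (_ ^+ _); rewrite mulnBr [(d * (m %/ d))%N]mulnC divnK.
- by rewrite exprVn.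
Qed.

(** As {m} = z [chebU m], the square split off in [lmov_poly_z2] cancels and leaves z^2 as
    denominator. *)
Lemma gm_integral_pos tau m t : (0 < tau)%N -> (0 < m)%N -> t != 0 ->
  exists S : 'I_m.+1 -> {poly int}, gm (Posz tau) m s t =
    \sum_(j < m.+1) ev ((s - s^-1) ^+ 2) (S j) / (s - s^-1) ^+ 2 * t ^ (m%:Z - 2 * j%:Z).
Proof.
move=> tau_gt0 m_gt0 t_neq0.
have /fin_all_exists[S SP] (j : 'I_m.+1) := lmov_poly_z2 tau_gt0 m_gt0 (leq_ord j).
exists S; rewrite gm_expansion //; apply: eq_bigr => j _.
have ssV := mulfV s_neq0; rewrite (SP j _ _ _ ssV).
have br_m : qbr s m%:Z = (s - s^-1) * ev (s + s^-1) (chebU m).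
  by rewrite (ev_chebU ssV) qbr_nat.
have : qbr s m%:Z != 0 by rewrite (qbr_neq0 s_generic).
rewrite br_m mulf_eq0 => /norP[z_neq0 U_neq0]; congr (_ * _).
  move: (s - s^-1) (ev _ (chebU m)) z_neq0 U_neq0 => z u z_neq0 u_neq0.
  by field; rewrite z_neq0 u_neq0.
have le_jm := leq_ord j.
rewrite exprVn !exprnN !exprnP -expfzDr //; congr (t ^ _); lia.
Qed.

Lemma gm_integral_neg tau m t : (0 < tau)%N -> (0 < m)%N -> t != 0 ->
  exists S : 'I_m.+1 -> {poly int}, gm (- Posz tau) m s t =
    \sum_(j < m.+1) ev ((s - s^-1) ^+ 2) (S j) / (s - s^-1) ^+ 2 * t ^ (m%:Z - 2 * j%:Z).
Proof.
move=> tau_gt0 m_gt0 t_neq0.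
have tV_neq0 : t^-1 != 0 by rewrite invr_neq0.
have [S SP] := gm_integral_pos tau_gt0 m_gt0 tV_neq0.
exists (fun j => - S (rev_ord j)); rewrite gm_opp // SP.
rewrite (reindex_inj rev_ord_inj) -sumrN /=; apply: eq_bigr => j _.
rewrite evN mulNr mulNr exprz_inv; congr (- (_ / _ * t ^ _)).
by have := leq_ord j; rewrite subSS; lia.
Qed.

(** For tau = 0 each Z_(m/d)(q^d, a^d) equals {m}_a / {m}^2 whatever d is, so the Moebius sum
    vanishes except for m = 1. *)
Lemma gm_integral_0 m t : (0 < m)%N -> t != 0 ->
  exists S : 'I_m.+1 -> {poly int}, gm 0 m s t =
    \sum_(j < m.+1) ev ((s - s^-1) ^+ 2) (S j) / (s - s^-1) ^+ 2 * t ^ (m%:Z - 2 * j%:Z).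
Proof.
move=> m_gt0 t_neq0.
pose f (d : nat) : F := qbr t m%:Z / qbr s m%:Z ^+ 2.
have gmE : gm 0 m s t = \sum_(d <- divisors m) (mobius d)%:~R * f d.
  apply: eq_big_seq => d; rewrite -dvdn_divisors // => dm; congr (_ * _).
  have d_gt0 := dvdn_gt0 m_gt0 dm.
  have sd_generic n : (s ^+ d) ^+ n.+1 - (s ^+ d)^-1 ^+ n.+1 != 0.
    rewrite -exprVn -!exprM; case: d d_gt0 {dm} => // d _.
    by rewrite mulSn addSn s_generic.
  have md_gt0 : (0 < m %/ d)%N by rewrite divn_gt0 // dvdn_leq.
  rewrite (Zn_tau0 nat_neq0 sd_generic _ md_gt0) /f.
  by rewrite !qbr_nat -[(s ^+ d)^-1]exprVn -[(t ^+ d)^-1]exprVn -!exprM [(d * _)%N]mulnC divnK.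
have [m1|m_gt1] := eqVneq m 1%N; last first.
  exists (fun _ => 0); rewrite gmE [RHS]big1 => [|j _]; last by rewrite ev0 !mul0r.
  have {}m_gt1 : (1 < m)%N by case: (m) m_gt0 m_gt1 => [|[]].
  rewrite (mobius_sum_prime _ (pdiv_prime m_gt1)) ?pdiv_dvd //.
  by apply: big1 => d _; rewrite /f subrr mulr0.
rewrite {}gmE {}/f; subst m.
have -> : divisors 1 = [:: 1%N] by [].
have -> : forall x : F, \sum_(d <- [:: 1%N]) (mobius d)%:~R * x = x.
  by move=> x; rewrite big_seq1 mul1r.
exists (fun j => if j == ord0 then 1 else - 1).
rewrite !big_ord_recl big_ord0 /= evN ev1 /qbr mulr0 subr0.
have -> : 1%:Z - 2 * (bump 0 0)%:Z = - 1%:Z by [].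
by rewrite !expr1z !exprN1; ring.
Qed.

Lemma gm_integral (tau : int) m t : (0 < m)%N -> t != 0 ->
  exists S : 'I_m.+1 -> {poly int}, gm tau m s t =
    \sum_(j < m.+1) ev ((s - s^-1) ^+ 2) (S j) / (s - s^-1) ^+ 2 * t ^ (m%:Z - 2 * j%:Z).
Proof.
case: tau => [[|n]|n] m_gt0 t_neq0; first exact: gm_integral_0.
  exact: gm_integral_pos.
by rewrite NegzE; apply: gm_integral_neg.
Qed.

End GmExpansion.

(** * Specialisation to the field of rational functions *)

Lemma Kfield_nat_neq0 n : n.+1%:R != 0 :> Kfield.
Proof.
by rewrite -(rmorph_nat (@FracField.tofrac _)) tofrac_eq0 -!polyC_natr !polyC_eq0 pnatr_eq0.
Qed.

Lemma qh_neq0 : qh != 0.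
Proof. by rewrite tofrac_eq0 polyX_eq0. Qed.

Lemma ah_neq0 : ah != 0.
Proof. by rewrite tofrac_eq0 polyC_eq0 polyX_eq0. Qed.

Lemma subr_exprV_neq0 (F : fieldType) (s : F) n : s != 0 ->
  s ^+ (n + n) != 1 -> s ^+ n - s^-1 ^+ n != 0.
Proof.
move=> s_neq0; apply: contra; rewrite subr_eq0 exprD => /eqP {1}->.
by rewrite -exprMn mulVf // expr1n.
Qed.

Lemma qh_generic n : qh ^+ n.+1 - qh^-1 ^+ n.+1 != 0.
Proof.
apply: (subr_exprV_neq0 qh_neq0).
rewrite /qh -tofracXn -tofrac1 tofrac_eq.
apply/eqP => /(congr1 (fun p : {poly {poly int}} => size p)).
by rewrite size_polyXn size_poly1.
Qed.

(* g_m = sum_{g>=0} sum_{Q in Z/2} n_{m,g,Q} z^{2g-2} a^Q with integer n,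
   finitely many nonzero; here c g k = n_{m,g,k/2}, and all nonzero c g k
   have g < N and |k| < N. *)
Theorem theorem1p4 (tau : int) (m : nat) : (0 < m)%N ->
  exists (N : nat) (c : nat -> int -> int),
    (forall (g : nat) (k : int), c g k != 0 -> (g < N)%N /\ `|k| < N%:Z) /\
    gm tau m qh ah =
      \sum_(g < N) \sum_(j < N.*2.+1)
         (c g (j%:Z - N%:Z))%:~R * (zvar ^+ g.*2 / zvar ^+ 2)
           * ah ^ (j%:Z - N%:Z).
Proof.
move=> m_gt0.
have [S ->] := gm_integral Kfield_nat_neq0 qh_neq0 qh_generic tau m_gt0 ah_neq0.
(* [N] exceeds m, hence every |m - 2j|, and is at least the number of coefficients of each [S j]. *)
rewrite -/zvar; pose N := maxn m.+1 (\max_(j < m.+1) size (S j)).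
pose e (j : nat) : int := m%:Z - 2 * j%:Z.
exists N, (fun g k => \sum_(j < m.+1 | e j == k) (S j)`_g).
have sizeS j : (size (S j) <= N)%N by rewrite leq_max (leq_bigmax j) orbT.
have lt_mN : (m < N)%N by rewrite leq_max leqnn.
split=> [g k|].
  move=> nz; have [j /eqP jk Sj] : exists2 j : 'I_m.+1, e j == k & (S j)`_g != 0.
    apply/exists_inP; apply: contraNT nz; rewrite negb_exists_in => /forall_inP S0.
    by rewrite big1 // => j /S0; rewrite negbK => /eqP.
  split; last by rewrite -jk /e; have := leq_ord j; lia.
  rewrite ltnNge; apply: contraNN Sj => le_Ng.
  by rewrite nth_default // (leq_trans (sizeS j)).
transitivity (\sum_(j < m.+1) \sum_(g < N)
    ((S j)`_g)%:~R * (zvar ^+ g.*2 / zvar ^+ 2) * ah ^ e j).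
  apply: eq_bigr => j _; rewrite -big_distrl /=; congr (_ * _).
  rewrite /ev (horner_coef_wide (n := N)) ?(leq_trans (size_poly _ _)) // big_distrl /=.
  by apply: eq_bigr => g _; rewrite coef_map -exprM mul2n mulrA.
rewrite exchange_big; apply: eq_bigr => g _ /=.
under [RHS]eq_bigr do rewrite rmorph_sum !big_distrl /=.
rewrite (exchange_big_dep xpredT) //=; apply: eq_bigr => j _.
(* Since m < N, each exponent [e j] is met by exactly one index, namely e j + N. *)
have lt_ej : (`|(e j + N%:Z)%R| < N.*2.+1)%N by rewrite /e; have := leq_ord j; lia.
rewrite (big_pred1 (Ordinal lt_ej)) => [|i] /=.
  by congr (_ * ah ^ _); rewrite /e; have := leq_ord j; lia.
by rewrite -val_eqE /= /e; have := leq_ord j; lia.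
Qed.
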